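(* Let $Q$ be a root lattice associated to a root system $\Phi$ of type $A$, $D$, or $E$. Then the conic-type subVOAs of $V_Q$ of the form $V_{C_\Delta}$, where $\Delta=\{\alpha_1,\dots,\alpha_r\}$ is a basis of $\Phi$ and $C_\Delta=\mathbb{Z}_{\ge0}\alpha_1\oplus\cdots\oplus\mathbb{Z}_{\ge0}\alpha_r$, are conjugate under $\mathrm{Aut}(V_Q)$.
   Context: $Q=\mathbb{Z}\Phi$ is the root lattice, normalized so that $(\alpha|\alpha)=2$ for $\alpha\in\Phi$; it is a positive-definite even lattice. A basis of $\Phi$ is a set of simple roots. $\mathrm{Aut}(V_Q)$ is the automorphism group of the VOA $V_Q$; conjugate means that for any two bases $\Delta,\Delta'$ of $\Phi$ some element of $\mathrm{Aut}(V_Q)$ maps $V_{C_\Delta}$ onto $V_{C_{\Delta'}}$. Lattice VOA. For a positive-definite even lattice $L$ put $\mathfrak{h}=\mathbb{C}\otimes_{\mathbb{Z}}L$ with the $\mathbb{C}$-bilinear extension of $(\cdot|\cdot)$, and $\hat{\mathfrak{h}}=\mathfrak{h}\otimes\mathbb{C}[t,t^{-1}]\oplus\mathbb{C}K$ with $K$ central, $h(m)=h\otimes t^m$, $[h_1(m),h_2(n)]=m\delta_{m+n,0}(h_1|h_2)K$. For $\lambda\in\mathfrak{h}$, $M_{\hat{\mathfrak{h}}}(1,\lambda)=U(\hat{\mathfrak{h}})\otimes_{U(\hat{\mathfrak{h}}_{\ge 0})}\mathbb{C}e^\lambda$, where $\hat{\mathfrak{h}}_{\ge 0}=\mathfrak{h}\otimes\mathbb{C}[t]\oplus\mathbb{C}K$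 acts by $K=1$, $h(0)e^\lambda=(h|\lambda)e^\lambda$, $h(n)e^\lambda=0$ for $n>0$. Let $\epsilon:L\times L\to\{\pm1\}$ be a 2-cocycle with $\epsilon(\alpha,\beta)\epsilon(\beta,\alpha)=(-1)^{(\alpha|\beta)}$ and $\epsilon(0,\alpha)=\epsilon(\alpha,0)=1$. The lattice VOA is $V_L=\bigoplus_{\alpha\in L}M_{\hat{\mathfrak{h}}}(1,\alpha)=M_{\hat{\mathfrak{h}}}(1,0)\otimes\mathbb{C}^\epsilon[L]$ with vacuum $\mathbf{1}=e^0$, $Y(h(-1)\mathbf{1},z)=\sum_{n}h(n)z^{-n-1}$, $Y(e^\alpha,z)=\exp\big(\sum_{n>0}\frac{\alpha(-n)}{n}z^n\big)\exp\big(-\sum_{n>0}\frac{\alpha(n)}{n}z^{-n}\big)e_\alpha z^\alpha$, where $e_\alpha(w\otimes e^\beta)=\epsilon(\alpha,\beta)w\otimes e^{\alpha+\beta}$ and $z^\alpha$ acts on $M_{\hat{\mathfrak{h}}}(1,\beta)$ as $z^{(\alpha|\beta)}$; $Y$ of a general $h_1(-n_1-1)\cdots h_k(-n_k-1)e^\alpha$ is the normally ordered product of the $\frac{1}{n_i!}\partial_z^{n_i}h_i(z)$ and $Y(e^\alpha,z)$. The Virasoro element is $\omega=\frac12\sum_i u_i(-1)^2\mathbf{1}$ for an orthonormal basis $\{u_i\}$ of $\mathfrak{h}$. For a submonoid $M\le L$ (a subset containing $0$ and closed under addition), $V_M=\bigoplus_{\gamma\in M}M_{\hat{\mathfrak{h}}}(1,\gamma)$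 is a subVOA of $V_L$; it is called conic-type when $M=\mathbb{Z}_{\ge0}\alpha_1\oplus\cdots\oplus\mathbb{Z}_{\ge0}\alpha_r$ for a $\mathbb{Z}$-basis $\{\alpha_i\}$ of $L$. *)

(* Defs.v *)
From HB Require Import structures.
From mathcomp Require Import all_boot all_order all_algebra.
From mathcomp Require Import finmap multiset complex.
From mathcomp Require Import monalg.
From mathcomp Require Import boolp classical_sets fsbigop reals.

Set Implicit Arguments.
Unset Strict Implicit.
Unset Printing Implicit Defensive.

Import Order.TTheory GRing.Theory Num.Theory.

Local Open Scope classical_set_scope.
Local Open Scope ring_scope.

(* The inner product of the Euclidean space R^r, and its *bilinear* (not
   Hermitian) extension to C^r. *)
Definition dot (K : comNzRingType) (r : nat) (x y : 'rV[K]_r) : K :=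
  \sum_i x 0 i * y 0 i.

Section RootSystems.
Variables (R : realType) (r : nat).
Implicit Types (Phi : {fset 'rV[R]_r}) (D : r.-tuple 'rV[R]_r).

Definition reflection (a x : 'rV[R]_r) : 'rV[R]_r :=
  x - (2 * dot x a / dot a a) *: a.

Definition is_root_system Phi : Prop :=
  [/\ 0 \notin Phi,
      <<enum_fset Phi>>%VS = fullv,
      forall (a : 'rV[R]_r) (c : R),
        a \in Phi -> c *: a \in Phi -> c = 1 \/ c = -1,
      forall a b : 'rV[R]_r, a \in Phi -> b \in Phi -> reflection a b \in Phi
    & forall a b : 'rV[R]_r, a \in Phi -> b \in Phi ->
        2 * dot b a / dot a a \is a Num.int].

Definition cone D : set 'rV[R]_r :=
  [set x | exists n : 'I_r -> nat, x = \sum_i tnth D i *+ n i].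

Definition is_basis Phi D : Prop :=
  [/\ {subset D <= Phi},
      basis_of fullv D
    & forall a : 'rV[R]_r, a \in Phi -> cone D a \/ cone D (- a)].

(* Edges of the Dynkin diagrams on the nodes 0, ..., n-1.  A_n is a path.
   D_n and E_n are the path 0 - 1 - ... - (n-2) with the node n-1 attached to
   the node n-3, resp. 2. *)
Definition path_edge (i j : nat) : bool := (i.+1 == j) || (j.+1 == i).

Definition fork_edge (n b i j : nat) : bool :=
  [|| [&& (i < n.-1)%N, (j < n.-1)%N & path_edge i j],
      (i == b) && (j == n.-1) | (i == n.-1) && (j == b)].

Definition has_dynkin_diagram D (edge : rel nat) : Prop :=
  forall i j : 'I_r,
    2 * dot (tnth D i) (tnth D j) / dot (tnth D j) (tnth D j) =
    (if i == j then 2 else if edge i j then -1 else 0).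

Definition ADE_diagram D : Prop :=
  [\/ (1 <= r)%N /\ has_dynkin_diagram D path_edge,
      (4 <= r)%N /\ has_dynkin_diagram D (fork_edge r (r - 3)%N)
    | (6 <= r <= 8)%N /\ has_dynkin_diagram D (fork_edge r 2)].

Definition of_type_ADE Phi : Prop :=
  exists2 D, is_basis Phi D & ADE_diagram D.

Definition root_lattice Phi : {pred 'rV[R]_r} :=
  fun x => `[< exists c : 'rV[R]_r -> int, x = \sum_(a <- Phi) a *~ c a >].

Lemma root_lattice_zmod_closed Phi : zmod_closed (root_lattice Phi).
Proof.
split=> [|x y /asboolP[c ->] /asboolP[d ->]].
  by apply/asboolP; exists (fun=> 0); rewrite big1.
apply/asboolP; exists (fun a => c a - d a).
by rewrite -sumrB; apply: eq_bigr => a _; rewrite mulrzBr.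
Qed.

HB.instance Definition _ Phi :=
  GRing.isZmodClosed.Build 'rV[R]_r (root_lattice Phi)
    (root_lattice_zmod_closed Phi).

End RootSystems.

(* Only the data of a vertex operator algebra; [vertex_op a N b] is the
   coefficient of z^N in Y(a,z)b, that is a_(-N-1) b. *)
Record voa_data (K : nzRingType) := Voa {
  voa_carrier :> lmodType K;
  vertex_op : voa_carrier -> int -> voa_carrier -> voa_carrier;
  vacuum : voa_carrier;
  conformal_vector : voa_carrier
}.

Definition is_voa_automorphism (K : nzRingType) (V : voa_data K)
    (g : {linear V -> V}) : Prop :=
  [/\ bijective g,
      g (vacuum V) = vacuum V,
      g (conformal_vector V) = conformal_vector V
    & forall (a b : V) (N : int),
        g (vertex_op a N b) = vertex_op (g a) N (g b)].

Section Fields.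
Variables (K : fieldType) (V : lmodType K).

(* [F N] is the coefficient of z^N. *)
Definition field := int -> V -> V.

Definition fderiv (F : field) : field := fun N v => (N + 1)%:~R *: F (N + 1) v.

(* (1/n!) d^n/dz^n *)
Definition fderiv_div (n : nat) (F : field) : field :=
  fun N v => (n`!%:R)^-1 *: iter n fderiv F N v.

(* :A(z)B(z): = A(z)_+ B(z) + B(z) A(z)_-, where A(z)_+ and A(z)_- are the parts
   of A(z) with nonnegative and negative powers of z.  When A(z) is a current
   sum_m h(m) z^(-m-1) or one of its derivatives, this puts the h(m), m >= 0, to
   the right.  The sums have finite support. *)
Definition normal_product (A B : field) : field := fun N v =>
  \sum_(i \in [set i : int | 0 <= i]) A i (B (N - i) v) +
  \sum_(i \in [set i : int | i < 0]) B (N - i) (A i v).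

(* The coefficient of t^N in X(t)^k and in exp X(t), where
   X(t) = sum_(n > 0) x_n t^n; since X has no constant term, only the powers
   k <= N contribute to the latter. *)
Fixpoint series_pow (x : nat -> V -> V) (k N : nat) (v : V) : V :=
  if k is k'.+1 then \sum_(1 <= n < N.+1) x n (series_pow x k' (N - n) v)
  else if N == 0%N then v else 0.

Definition series_exp (x : nat -> V -> V) (N : nat) (v : V) : V :=
  \sum_(k < N.+1) (k`!%:R)^-1 *: series_pow x k N v.

End Fields.

Section LatticeVOA.
Variables (R : realType) (r : nat) (L : zmodClosed 'rV[R]_r).

Definition lattice := {x : 'rV[R]_r | x \in L}.
HB.instance Definition _ := [isSub of lattice for @sval _ _].
HB.instance Definition _ := [Choice of lattice by <:].
HB.instance Definition _ := [SubChoice_isSubZmodule of lattice by <:].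

Implicit Types (alpha beta gamma : lattice) (eps : lattice -> lattice -> int).

Definition is_cocycle eps : Prop :=
  [/\ forall alpha beta, eps alpha beta = 1 \/ eps alpha beta = -1,
      forall alpha beta gamma,
        eps alpha beta * eps (alpha + beta) gamma =
        eps beta gamma * eps alpha (beta + gamma),
      forall alpha beta (k : int), dot (\val alpha) (\val beta) = k%:~R ->
        eps alpha beta * eps beta alpha = (-1) ^ k
    & forall alpha, eps 0 alpha = 1 /\ eps alpha 0 = 1].

Local Notation C := R[i]%C.

(* h = C (x)_Z L, identified with C^r when L has rank r.  The rows of the
   identity matrix are an orthonormal basis of h. *)
Local Notation h := 'rV[C]_r.
Definition to_h alpha : h := map_mx (real_complex R) (\val alpha).
Definition ubasis (i : 'I_r) : h := delta_mx 0 i.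

(* u_i is [ubasis i].  By the PBW theorem M(1,beta) has as basis the vectors
   u_{i1}(-n1-1) ... u_{ik}(-nk-1) e^beta, indexed by the finite multisets of
   pairs (i,n); V_L is the sum of the M(1,beta), so it is free on [basis_index]. *)
Definition basis_index : choiceType :=
  ({mset 'I_r * nat}%mset * lattice)%type.
Definition VL : lmodType C := {malg C[basis_index]}.

Definition basis_vector (b : basis_index) : VL := mkmalgU b 1.

Definition linext (W : lmodType C) (f : basis_index -> W) (v : VL) : W :=
  \sum_(b <- msupp v) mcoeff b v *: f b.

Definition exp_vector beta : VL := basis_vector (mset0, beta).

Definition heis_basis (i : 'I_r) (m : int) (b : basis_index) : VL :=
  match m with
  | Negz n => basis_vector (((i, n) +` b.1)%mset, b.2)
  | Posz 0 => to_h b.2 0 i *: basis_vector b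
  | Posz n.+1 =>
      (n.+1 * b.1 (i, n))%N%:R *: basis_vector ((b.1 `\ (i, n))%mset, b.2)
  end.

(* The action of h(m) for h in C^r; K acts as 1. *)
Definition heis (x : h) (m : int) : VL -> VL :=
  fun v => \sum_i x 0 i *: linext (heis_basis i m) v.

Lemma linext_sub (W : lmodType C) (f : basis_index -> W) (v : VL)
    (d : {fset basis_index}) :
  {subset msupp v <= d} -> linext f v = \sum_(b <- d) mcoeff b v *: f b.
Proof.
move=> sub; rewrite /linext; apply: big_fset_incl; first exact/fsubsetP.
by move=> b _ /mcoeff_outdom ->; rewrite scale0r.
Qed.

Lemma linext_is_linear (W : lmodType C) (f : basis_index -> W) :
  linear (linext f).
Proof.
move=> c u v; pose d := (msupp u `|` msupp v `|` msupp (c *: u + v))%fset.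
have [du [dv dw]] : {subset msupp u <= d} /\ {subset msupp v <= d} /\
    {subset msupp (c *: u + v) <= d}.
  by split; [|split] => b; rewrite !inE => ->; rewrite ?orbT.
rewrite (linext_sub _ du) (linext_sub _ dv) (linext_sub _ dw).
rewrite scaler_sumr -big_split; apply: eq_bigr => b _ /=.
by rewrite mcoeffD mcoeffZ scalerDl scalerA.
Qed.

HB.instance Definition _ (W : lmodType C) (f : basis_index -> W) :=
  GRing.isLinear.Build C VL W *:%R (linext f) (linext_is_linear f).

Lemma linext_basis (W : lmodType C) (f : basis_index -> W) b :
  linext f (basis_vector b) = f b.
Proof.
rewrite (@linext_sub _ _ _ [fset b]%fset).
  by rewrite big_seq_fset1 mcoeffUU scale1r.
by apply/fsubsetP; exact: msuppU_le.
Qed.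

Lemma VL_ext (W : lmodType C) (f g : {linear VL -> W}) :
  (forall b, f (basis_vector b) = g (basis_vector b)) -> f =1 g.
Proof.
move=> fg v; have -> : v = \sum_(b <- msupp v) mcoeff b v *: basis_vector b.
  rewrite [LHS]monalgE; apply: eq_bigr => b _; apply/malgP => k.
  by rewrite mcoeffZ !mcoeffU mulrnAr mulr1.
by rewrite !linear_sum; apply: eq_bigr => b _; rewrite !linearZ /= fg.
Qed.

Opaque basis_vector linext to_h.

Lemma heis_is_linear x m : linear (heis x m).
Proof.
move=> c u v; rewrite /heis scaler_sumr -big_split; apply: eq_bigr => i _ /=.
by rewrite linearP scalerDr !scalerA mulrC.
Qed.

HB.instance Definition _ x m :=
  GRing.isLinear.Build C VL VL *:%R (heis x m) (heis_is_linear x m).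

Lemma heis_ubasis i m b : heis (ubasis i) m (basis_vector b) = heis_basis i m b.
Proof.
rewrite /heis (bigD1 i) //= big1 => [|j ji]; rewrite /ubasis mxE eqxx.
  by rewrite eqxx scale1r addr0 linext_basis.
by rewrite (negPf ji) scale0r.
Qed.

Lemma linextZ (W : lmodType C) (f : basis_index -> W) c v :
  linext f (c *: v) = c *: linext f v.
Proof. exact: linearZ. Qed.

Lemma linextZ_basis (W : lmodType C) (f : basis_index -> W) c b :
  linext f (c *: basis_vector b) = c *: f b.
Proof. by rewrite linearZ /= linext_basis. Qed.

Lemma osc_comm i j m n v :
  linext (heis_basis i m) (linext (heis_basis j n) v)
    - linext (heis_basis j n) (linext (heis_basis i m) v) =
  ((i == j) && (m + n == 0))%:R *: (m%:~R *: v) :> VL.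
Proof.
pose F := linext (heis_basis i m) \o linext (heis_basis j n)
          \- (linext (heis_basis j n) \o linext (heis_basis i m)).
pose G := (((i == j) && (m + n == 0))%:R * m%:~R) \*: (@idfun VL).
have -> : ((i == j) && (m + n == 0))%:R *: (m%:~R *: v) = G v.
  by rewrite /G /= scalerA.
rewrite -[LHS]/(F v); apply: VL_ext => -[A b]; rewrite {}/F {}/G /= !linext_basis.
have diffZZ f g c d b1 b2 :
    linext f (c *: basis_vector b1) - linext g (d *: basis_vector b2) =
    c *: f b1 - d *: g b2 :> VL by rewrite !linextZ_basis.
have diffUZ f g d b1 b2 :
    linext f (basis_vector b1) - linext g (d *: basis_vector b2) =
    f b1 - d *: g b2 :> VL by rewrite linext_basis linextZ_basis.
have diffZU f g c b1 b2 :
    linext f (c *: basis_vector b1) - linext g (basis_vector b2) =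
    c *: f b1 - g b2 :> VL by rewrite linext_basis linextZ_basis.
have diffUU f g b1 b2 :
    linext f (basis_vector b1) - linext g (basis_vector b2) =
    f b1 - g b2 :> VL by rewrite !linext_basis.
case: m n => [[|m]|m] [[|n]|n]; rewrite [heis_basis _ _ (A, b)]/= [heis_basis _ _ (A, b)]/=.
all: first [rewrite diffUU | rewrite diffUZ | rewrite diffZU | rewrite diffZZ].
all: rewrite /= ?andbF ?mul0r ?mulr0 ?scale0r ?scalerA.
- by rewrite mulrC subrr.
- by rewrite mulrC subrr.
- by rewrite subrr.
- by rewrite mulrC subrr.
- rewrite -!natrM !(msetE2, msetnE).
  have -> : (A `\ (j, n) `\ (i, m) = A `\ (i, m) `\ (j, n))%mset.
    by apply/msetP => x; rewrite !(msetE2, msetnE) subnAC.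
  apply/eqP; rewrite subr_eq0; apply/eqP; congr (_%:R *: _).
  rewrite mulnACA [RHS]mulnACA [(m.+1 * _)%N]mulnC; congr (_ * _)%N.
  by have [[-> ->]|_] := eqVneq (i, m) (j, n); rewrite // !subn0 mulnC.
- have -> : (Posz m.+1 + Negz n == 0) = (m == n).
    by rewrite NegzE subr_eq0 eqz_nat eqSS.
  rewrite !(msetE2, msetnE) xpair_eqE.
  have [/andP[/eqP <- /eqP <-]|ne] := boolP ((i == j) && (m == n)).
    rewrite mul1r.
    have -> : (((i, m) +` A) `\ (i, m) = A)%mset.
      by apply/msetP => x; rewrite !(msetE2, msetnE) addKn.
    have [A0|Agt] := posnP (A (i, m)).
      by rewrite A0 muln0 scale0r subr0 addn0 muln1 pmulrn.
    have -> : ((i, m) +` (A `\ (i, m)) = A)%mset.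
      apply/msetP => x; rewrite !(msetE2, msetnE); case: eqP => [->|_]; last by rewrite subn0.
      by rewrite subnKC.
    by rewrite -scalerBl -natrB ?leq_mul2l ?leq_addl ?orbT // -mulnBr addnK muln1.
  rewrite mul0r scale0r add0n.
  have -> : (((j, n) +` A) `\ (i, m) = (j, n) +` (A `\ (i, m)))%mset.
    apply/msetP => x; rewrite !(msetE2, msetnE).
    have [->|_] := eqVneq x (i, m); last by rewrite !subn0.
    by rewrite xpair_eqE (negPf ne).
  by rewrite subrr.
- by rewrite subrr.
- have -> : (Negz m + Posz n.+1 == 0) = (m == n).
    by rewrite NegzE addrC subr_eq0 eqz_nat eqSS eq_sym.
  rewrite !(msetE2, msetnE) xpair_eqE.
  have [/andP[/eqP <- /eqP <-]|ne] := boolP ((i == j) && (m == n)).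
    rewrite mul1r !eqxx.
    have -> : (((i, m) +` A) `\ (i, m) = A)%mset.
      by apply/msetP => x; rewrite !(msetE2, msetnE) addKn.
    have [A0|Agt] := posnP (A (i, m)).
      by rewrite A0 muln0 scale0r sub0r addn0 muln1 NegzE mulrNz scaleNr.
    have -> : ((i, m) +` (A `\ (i, m)) = A)%mset.
      apply/msetP => x; rewrite !(msetE2, msetnE); case: eqP => [->|_]; last by rewrite subn0.
      by rewrite subnKC.
    rewrite -opprB -scalerBl -natrB ?leq_mul2l ?leq_addl ?orbT // -mulnBr addnK muln1.
    by rewrite NegzE mulrNz scaleNr.
  rewrite mul0r scale0r [j == i]eq_sym [n == m]eq_sym (negPf ne) add0n.
  have -> : (((i, m) +` A) `\ (j, n) = (i, m) +` (A `\ (j, n)))%mset.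
    apply/msetP => x; rewrite !(msetE2, msetnE).
    have [->|_] := eqVneq x (i, m); last by rewrite !add0n.
    by rewrite xpair_eqE (negPf ne) !subn0.
  by rewrite subrr.
- have -> : ((i, m) +` ((j, n) +` A) = (j, n) +` ((i, m) +` A))%mset.
    by apply/msetP => x; rewrite !(msetE2, msetnE) addnCA.
  by rewrite subrr.
Qed.

Lemma heis_comm x y m n v :
  heis x m (heis y n v) - heis y n (heis x m v) =
  ((m + n == 0)%:R * m%:~R * dot x y) *: v.
Proof.
have E x1 m1 y1 n1 : heis x1 m1 (heis y1 n1 v) = \sum_i \sum_j
    (x1 0 i * y1 0 j) *:
      linext (heis_basis i m1) (linext (heis_basis j n1) v).
  apply: eq_bigr => i _; rewrite (linear_sum (linext _)) scaler_sumr.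
  by apply: eq_bigr => j _ /=; rewrite linextZ scalerA.
rewrite !E [X in _ - X]exchange_big -sumrB /dot mulr_sumr scaler_suml.
apply: eq_bigr => i _; rewrite -sumrB (bigD1 i) //= [X in _ + X]big1 ?addr0.
  rewrite [y 0 i * _]mulrC -scalerBr osc_comm eqxx /= !scalerA.
  by congr (_ *: _); rewrite -mulrA mulrC.
move=> j ji; rewrite [y 0 j * _]mulrC -scalerBr osc_comm.
by rewrite eq_sym (negPf ji) scale0r scaler0.
Qed.

Lemma heis0_exp x beta :
  heis x 0 (exp_vector beta) = dot x (to_h beta) *: exp_vector beta.
Proof.
rewrite /heis /dot scaler_suml; apply: eq_bigr => i _.
by rewrite linext_basis /= scalerA.
Qed.

Lemma heis_pos_exp x n beta : heis x (Posz n.+1) (exp_vector beta) = 0.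
Proof.
rewrite /heis big1 // => i _.
by rewrite linext_basis /= mset0E muln0 scale0r scaler0.
Qed.

Lemma seq_mset_nil (T : choiceType) : seq_mset [::] = mset0 :> {mset T}%mset.
Proof. by apply/msetP => x; rewrite mset_seqE mset0E. Qed.

Lemma seq_mset_cons (T : choiceType) (x : T) s :
  seq_mset (x :: s) = (x +` seq_mset s)%mset.
Proof.
by apply/msetP => y; rewrite msetE2 msetnE !mset_seqE /= eq_sym; case: eqP.
Qed.

Lemma basis_vectorE b :
  basis_vector b =
  foldr (fun p => heis (ubasis p.1) (Negz p.2)) (exp_vector b.2)
        (enum_mset b.1).
Proof.
case: b => A beta /=; rewrite -{1}[A]seq_mset_id.
elim: (enum_mset A) => [|[i k] s IHs]; first by rewrite seq_mset_nil.
rewrite seq_mset_cons /= -IHs; symmetry; exact: heis_ubasis.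
Qed.

(* With [heis_comm], [heis0_exp], [heis_pos_exp] and [basis_vectorE] (e^beta
   generates, whence uniqueness of f), this says that the span of the
   basis_vector (A, beta) is the induced module M(1,beta). *)
Lemma fock_induced (W : lmodType C) (H : h -> int -> W -> W) beta (w : W) :
  (forall x m, linear (H x m)) ->
  (forall m u, linear (fun x => H x m u)) ->
  (forall x y m n u, H x m (H y n u) - H y n (H x m u) =
                     ((m + n == 0)%:R * m%:~R * dot x y) *: u) ->
  (forall x, H x 0 w = dot x (to_h beta) *: w) ->
  (forall x n, H x (Posz n.+1) w = 0) ->
  exists f : VL -> W,
    [/\ linear f,
        f (exp_vector beta) = w
      & forall x m A, f (heis x m (basis_vector (A, beta))) =
                      H x m (f (basis_vector (A, beta)))].
Proof.
move=> Hlin Hlinx Hcomm Hw0 Hwp.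
have HZ x m c u : H x m (c *: u) = c *: H x m u.
  have H0 : H x m 0 = 0.
    by have := Hlin x m 1 0 0; rewrite !scale1r addr0 => /esym/(canRL (addrK _)); rewrite subrr.
  by rewrite -[c *: u]addr0 Hlin H0 addr0.
have Hx0 m u : H 0 m u = 0.
  by have := Hlinx m u 1 0 0; rewrite !scale1r addr0 => /esym/(canRL (addrK _)); rewrite subrr.
have HxE x m u : H x m u = \sum_i x 0 i *: H (ubasis i) m u.
  rewrite {1}(row_sum_delta x).
  elim/big_rec2: _ => [|i u' x' _ IH]; first exact: Hx0.
  by rewrite Hlinx IH.
have dotu i j : dot (ubasis i) (ubasis j) = (i == j)%:R.
  rewrite /dot (bigD1 i) //= big1 => [|k ki].
    by rewrite !mxE !eqxx addr0 mul1r.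
  by rewrite !mxE (negPf ki) andbF mul0r.
pose cr (p : 'I_r * nat) := H (ubasis p.1) (Negz p.2).
have crC p q u : cr p (cr q u) = cr q (cr p u).
  by apply/eqP; rewrite -subr_eq0 Hcomm !mul0r scale0r.
pose fs s := foldr cr w s.
have fs_perm s t : perm_eq s t -> fs s = fs t.
  apply: (catCA_perm_subst (F := fs)) => t1 t2 t3.
  elim: t1 t2 => [|p t1 IH] t2 //=.
  rewrite -/(fs _) IH; elim: t2 => [|q t2 IH2] //=.
  by rewrite -/(fs _) -/(fs _) crC [X in cr q X]IH2.
have fs0 x s : H x 0 (fs s) = dot x (to_h beta) *: fs s.
  elim: s => [|p s IH] /=; first exact: Hw0.
  have := Hcomm x (ubasis p.1) 0 (Negz p.2) (fs s).
  rewrite mulr0 mul0r scale0r => /eqP; rewrite subr_eq0 => /eqP.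
  by rewrite IH HZ.
have fs_pos i k s : H (ubasis i) (Posz k.+1) (fs s) =
    (k.+1 * count_mem (i, k) s)%N%:R *: fs (rem (i, k) s).
  elim: s => [|[j l] s IH] /=; first by rewrite Hwp muln0 scale0r.
  have /eqP := Hcomm (ubasis i) (ubasis j) (Posz k.+1) (Negz l) (fs s).
  rewrite subr_eq => /eqP; rewrite /cr /= => ->; rewrite IH HZ dotu.
  have -> : (Posz k.+1 + Negz l == 0) = (k == l).
    by rewrite NegzE subr_eq0 eqz_nat eqSS.
  rewrite xpair_eqE [j == i]eq_sym [l == k]eq_sym.
  have [e|ne] := boolP ((i == j) && (k == l)); last first.
    have -> : (k == l)%:R * (Posz k.+1)%:~R * (i == j)%:R = 0 :> C.
      by move: ne; case: (i == j); case: (k == l) => //= _; rewrite ?mul0r ?mulr0.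
    by rewrite scale0r add0r add0n.
  have /andP[/eqP ij /eqP kl] := e; subst j l; rewrite !eqxx mul1r mulr1.
  have [i0|ins] := boolP ((i, k) \in s); last first.
    by rewrite (count_memPn ins) muln0 scale0r addr0 muln1 pmulrn.
  rewrite -[H _ _ (fs (rem _ _))]/(fs ((i, k) :: rem (i, k) s)).
  rewrite -(fs_perm _ _ (perm_to_rem i0)) -scalerDl; congr (_ *: _).
  by rewrite mulnDr muln1 natrD pmulrn.
pose fb (b : basis_index) := if b.2 == beta then fs (enum_mset b.1) else 0.
exists (linext fb); split; first exact: linext_is_linear.
  rewrite linext_basis /fb eqxx /=.
  by rewrite -[RHS]/(fs [::]); apply: fs_perm; rewrite -seq_mset_nil perm_eq_seq_mset.
move=> x m A; rewrite linext_basis {2}/fb eqxx /= HxE /heis.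
rewrite (linear_sum (linext _)); apply: eq_bigr => i _ /=.
rewrite linextZ linext_basis; congr (_ *: _).
case: m => [[|k]|k] /=.
- rewrite linextZ_basis /fb eqxx fs0 /=; congr (_ *: _).
  rewrite /dot (bigD1 i) //= big1 => [|j ji]; rewrite !mxE.
    by rewrite !eqxx mul1r addr0.
  by rewrite (negPf ji) mul0r.
- rewrite linextZ_basis /fb eqxx fs_pos /= -count_mem_mset; congr (_ *: _).
  apply: fs_perm; apply/allP => q _; apply/eqP.
  by rewrite /= count_mem_mset msetE2 msetnE count_mem_rem !count_mem_mset [_ == q]eq_sym;
    case: eqP.
- rewrite linext_basis /fb eqxx -[RHS]/(fs ((i, k) :: enum_mset A)).
  apply: fs_perm; apply/allP => q _; apply/eqP.
  by rewrite /= !count_mem_mset msetE2 msetnE [_ == q]eq_sym; case: eqP.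
Qed.

Transparent basis_vector linext to_h.

(* h(z) = sum_m h(m) z^(-m-1) *)
Definition current (x : h) : field VL := fun N => heis x (- N - 1).

Section Cocycle.
Variable eps : lattice -> lattice -> int.

(* e_alpha *)
Definition shift alpha : VL -> VL :=
  linext (fun b => (eps alpha b.2)%:~R *: basis_vector (b.1, alpha + b.2)).

(* Y(e^alpha,z); on M(1,beta) the coefficient of z^N collects the terms z^k of
   the first exponential and z^(-l) of the second with k - l + (alpha|beta) = N.
   Only finitely many of them are nonzero. *)
Definition Y_exp alpha : field VL := fun N =>
  linext (fun b =>
    \sum_(p \in [set p : nat * nat |
                 p.1%:R - p.2%:R + dot (\val alpha) (\val b.2) = N%:~R])
      series_exp (fun n v => n%:R^-1 *: heis (to_h alpha) (- n%:Z) v) p.1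
        (series_exp (fun n v => - (n%:R^-1 *: heis (to_h alpha) n%:Z v)) p.2
          (shift alpha (basis_vector b)))).

Definition Y_basis (b : basis_index) : field VL :=
  foldr (fun p : 'I_r * nat =>
           normal_product (fderiv_div p.2 (current (ubasis p.1))))
    (Y_exp b.2) (enum_mset b.1).

Definition Y_lattice (a : VL) : field VL := fun N v =>
  linext (fun b => Y_basis b N v) a.

Definition lattice_voa : voa_data C :=
  {| voa_carrier := VL;
     vertex_op := Y_lattice;
     vacuum := exp_vector 0;
     conformal_vector :=
       2%:R^-1 *: \sum_i heis (ubasis i) (-1)
                           (heis (ubasis i) (-1) (exp_vector 0)) |}.

(* V_M, the sum of the M(1,gamma) for gamma in M *)
Definition sub_lattice_voa (M : set lattice) : set lattice_voa :=
  [set v : VL | forall b : basis_index, b \in msupp v -> M b.2].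

Definition conic_voa (D : r.-tuple 'rV[R]_r) : set lattice_voa :=
  sub_lattice_voa [set gamma | cone D (\val gamma)].

End Cocycle.
End LatticeVOA.

Arguments sub_lattice_voa {R r L} eps M : simpl never.
Arguments conic_voa {R r L} eps D : simpl never.

(* Main.v *)
Require Import Defs.
From HB Require Import structures.
From mathcomp Require Import all_boot all_order all_algebra.
From mathcomp Require Import finmap multiset complex.
From mathcomp Require Import monalg.
From mathcomp Require Import boolp classical_sets functions cardinality fsbigop reals.
From mathcomp Require Import zify ring lra.

(** Two bases of a root system are exchanged by an element of the Weyl group,
    that is, by an isometry of the root lattice that permutes the roots
    ([bases_conjugate]).  It is therefore enough to lift an isometry [w] of Q to
    an automorphism [g] of V_Q that maps the summand M(1,beta) onto
    M(1,w beta): such a [g] maps V_M onto V_(w M) for every submonoid M.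

    The lift is [g (h_1(-n_1) ... h_k(-n_k) e^beta) =
    u(beta) (w h_1)(-n_1) ... (w h_k)(-n_k) e^(w beta)] with signs [u(beta)] such
    that [eps(alpha,beta) u(alpha + beta) =
    u(alpha) u(beta) eps(w alpha, w beta)].  They exist because the quotient of
    [eps] by its pullback along [w] is a symmetric 2-cocycle (both have the
    commutator [(-1)^(alpha|beta)]), hence defines an abelian extension of Q,
    which splits since Q is free ([cocycle_lift]).

    By construction [g] intertwines [h(m)] with [(w h)(m)], and the equation for
    [u] makes it intertwine [Y(e^alpha,z)] with [u(alpha) Y(e^(w alpha),z)]
    ([lift_Y_exp]).  All other vertex operators are generated from these:
    [Y(h(-n-1) a, z)] is the normally ordered product of a derivative of [h(z)]
    and [Y(a,z)] ([Y_lattice_heis]).  This is the definition of [Y] only for [h]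
    in the fixed orthonormal basis, with the factors in a fixed order; that the
    order does not matter rests on the commutation of the creation operators
    among themselves and of the annihilation operators among themselves
    ([normal_productCA]).  The sums in the definition of [Y] are finite because
    every field involved has only finitely many negative powers of [z] on a
    given vector, and this finiteness makes the normally ordered product
    bilinear.  The Virasoro element is preserved because [w] maps an orthonormal
    basis to an orthonormal basis, and the lift of the inverse isometry with the
    corresponding signs is the inverse of [g]. *)

Set Implicit Arguments.
Unset Strict Implicit.
Unset Printing Implicit Defensive.

Import Order.TTheory GRing.Theory Num.Theory.

Local Open Scope classical_set_scope.
Local Open Scope ring_scope.

(** * Isometries of a root system *)

Section Dot.
Variables (K : comNzRingType) (r : nat).
Implicit Types x y z : 'rV[K]_r.

Lemma dotC x y : dot x y = dot y x.
Proof. by apply: eq_bigr => i _; rewrite mulrC. Qed.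

Lemma dotDl x y z : dot (x + y) z = dot x z + dot y z.
Proof. by rewrite -big_split; apply: eq_bigr => i _; rewrite mxE mulrDl. Qed.

Lemma dotZl c x y : dot (c *: x) y = c * dot x y.
Proof. by rewrite mulr_sumr; apply: eq_bigr => i _; rewrite mxE mulrA. Qed.

Lemma dot_mx x y : dot x y = (x *m y^T) 0 0.
Proof. by rewrite mxE; apply: eq_bigr => i _; rewrite mxE. Qed.

Lemma dot_orthogonal (M : 'M[K]_r) x y :
  M *m M^T = 1%:M -> dot (x *m M) (y *m M) = dot x y.
Proof. by move=> MM; rewrite !dot_mx trmx_mul mulmxA -(mulmxA x) MM mulmx1. Qed.
End Dot.

Section Weyl.
Variables (R : realType) (r : nat).
Implicit Types (D : r.-tuple 'rV[R]_r) (a x : 'rV[R]_r).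

Definition reflection_mx a : 'M[R]_r := 1%:M - (2 / dot a a) *: (a^T *m a).

Lemma mul_reflection_mx a x : x *m reflection_mx a = reflection a x.
Proof.
rewrite mulmxBr mulmx1 -scalemxAr mulmxA /reflection mulrAC.
by rewrite [x *m _]mx11_scalar -dot_mx mul_scalar_mx scalerA.
Qed.

Lemma tr_reflection_mx a : (reflection_mx a)^T = reflection_mx a.
Proof. by rewrite linearB linearZ /= trmx1 trmx_mul trmxK. Qed.

Lemma reflection_mxK a : dot a a != 0 ->
  reflection_mx a *m (reflection_mx a)^T = 1%:M.
Proof.
move=> aa0; apply/row_matrixP => i; rewrite !rowE mulmx1 mulmxA tr_reflection_mx.
rewrite !mul_reflection_mx; set x := delta_mx 0 i.
(* The coefficient of [a] in [x] changes sign under the reflection. *)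
rewrite {1}/reflection; set k := 2 * _ / _; suff -> : k = - (2 * dot x a / dot a a).
  by rewrite scaleNr opprK subrK.
by rewrite /k /reflection dotDl -scaleNr dotZl; field.
Qed.

Lemma basis_coordE D x : basis_of fullv D ->
  x = \sum_i coord D i x *: tnth D i.
Proof.
move=> bD; rewrite {1}(coord_basis bD (memvf x)).
by apply: eq_bigr => i _; rewrite (tnth_nth 0).
Qed.

Lemma coord_basis_sum D (c : 'I_r -> R) i : basis_of fullv D ->
  coord D i (\sum_j c j *: tnth D j) = c i.
Proof.
move=> /basis_free fD; under eq_bigr do rewrite (tnth_nth 0).
exact: coord_sum_free.
Qed.

Lemma coneP D x : basis_of fullv D ->
  cone D x <-> forall i, coord D i x \is a Num.nat.
Proof.
move=> bD; split=> [[n ->] i|xnat].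
  under eq_bigr do rewrite -scaler_nat.
  by rewrite coord_basis_sum.
exists (fun i => Num.truncn (coord D i x)); rewrite {1}(basis_coordE x bD).
by apply: eq_bigr => i _; rewrite -scaler_nat truncnK.
Qed.

Lemma coord_tnth D i j : basis_of fullv D -> coord D i (tnth D j) = (i == j)%:R.
Proof.
move=> /basis_free fD; rewrite (tnth_nth 0) coord_free // eq_sym.
by rewrite -val_eqE.
Qed.

Lemma coord_reflection D i j x : basis_of fullv D -> j != i ->
  coord D j (reflection (tnth D i) x) = coord D j x.
Proof.
move=> bD ji; rewrite /reflection linearB linearZ /= coord_tnth //.
by rewrite (negPf ji) mulr0 subr0.
Qed.

Lemma dot_root_neq0 (Phi : {fset 'rV[R]_r}) a :
  is_root_system Phi -> a \in Phi -> dot a a != 0.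
Proof.
case=> /negP Phi0 _ _ _ _ aP; apply/negP => /eqP aa0; apply: Phi0.
suff -> : 0 = a by [].
apply/esym/rowP => i; rewrite mxE; apply/eqP; rewrite -sqrf_eq0 expr2.
apply/eqP; apply: (psumr_eq0P (P := xpredT) _ aa0) => // j _.
by rewrite -expr2 sqr_ge0.
Qed.

Section RootSystem.
Variables (Phi : {fset 'rV[R]_r}) (rsPhi : is_root_system Phi).

(** The reflection in a simple root changes no coefficient but that of this
    root.  A positive root other than it has another positive coefficient,
    because a root and its opposite are the only roots on their line, and the
    nonzero coefficients of a root all have the same sign. *)
Lemma reflection_positive D i a : is_basis Phi D -> a \in Phi -> cone D a ->
  a != tnth D i -> cone D (reflection (tnth D i) a).
Proof.
move=> [DP bD Dpos] aP aD ai; have [_ _ Pred Prefl _] := rsPhi.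
have iP : tnth D i \in Phi by exact/DP/mem_tnth.
have [//|/(coneP _ bD) neg] := Dpos _ (Prefl _ _ iP aP).
have a0 j : j != i -> coord D j a = 0.
  move=> ji; have := neg j; rewrite linearN /= coord_reflection // => /natr_ge0.
  move/(coneP _ bD)/(_ j)/natr_ge0: aD => aj.
  by rewrite oppr_ge0 => aj'; apply/eqP; rewrite eq_le aj aj'.
have aE : a = coord D i a *: tnth D i.
  rewrite {1}(basis_coordE a bD) (bigD1 i) //= big1 ?addr0 // => j ji.
  by rewrite a0 // scale0r.
have caP : coord D i a *: tnth D i \in Phi by rewrite -aE.
have [c1|cN1] := Pred _ _ iP caP.
- by move: ai; rewrite aE c1 scale1r eqxx.
- move/(coneP _ bD)/(_ i)/natr_ge0: aD.
  by rewrite cN1 oppr_ge0 ler10.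
Qed.

Lemma reflection_opp a : dot a a != 0 -> reflection a a = - a.
Proof.
by move=> aa; rewrite /reflection mulfK // -{1}[a]scale1r -scalerBl opprD addNKr scaleN1r.
Qed.

(** Roots are row vectors, so that [M] acts from the right, with inverse [M^T]. *)
Definition root_isometry (M : 'M[R]_r) : Prop :=
  [/\ M *m M^T = 1%:M,
      forall a, a \in Phi -> a *m M \in Phi
    & forall a, a \in Phi -> a *m M^T \in Phi].

Lemma root_isometry_refl a : a \in Phi -> root_isometry (reflection_mx a).
Proof.
move=> aP; have [_ _ _ Prefl _] := rsPhi.
split; first exact/reflection_mxK/(dot_root_neq0 rsPhi aP).
  by move=> b bP; rewrite mul_reflection_mx Prefl.
by move=> b bP; rewrite tr_reflection_mx mul_reflection_mx Prefl.
Qed.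

Lemma root_isometryM M N :
  root_isometry M -> root_isometry N -> root_isometry (M *m N).
Proof.
move=> [MM MP MTP] [NN NP NTP]; split=> [|a aP|a aP].
- by rewrite trmx_mul mulmxA -(mulmxA M) NN mulmx1.
- by rewrite mulmxA NP ?MP.
- by rewrite trmx_mul mulmxA MTP ?NTP.
Qed.

Lemma cone_mx D M x : M *m M^T = 1%:M ->
  cone [tuple of map (mulmxr M) D] (x *m M) <-> cone D x.
Proof.
move=> MM; split=> -[n xn]; exists n; last first.
  rewrite xn mulmx_suml; apply: eq_bigr => i _.
  by rewrite tnth_map -scaler_nat -scalemxAl scaler_nat.
rewrite -[x]mulmx1 -MM mulmxA xn mulmx_suml; apply: eq_bigr => i _.
by rewrite tnth_map -scaler_nat -scalemxAl /= -mulmxA MM mulmx1 scaler_nat.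
Qed.

Lemma is_basis_mx D M : root_isometry M -> is_basis Phi D ->
  is_basis Phi [tuple of map (mulmxr M) D].
Proof.
move=> [MM MP MTP] [DP bD Dpos].
have MTM : M^T *m M = 1%:M by exact: mulmx1C.
split=> [x /mapP[y yD ->]||a aP].
- exact/MP/DP.
- rewrite basisEfree subvf; apply/and3P; split=> //; last first.
    by rewrite size_tuple dimvf /dim /= mul1n.
  apply/freeP => c c0 i.
  have : \sum_j c j *: tnth D j = 0.
    transitivity ((\sum_j c j *: (map (mulmxr M) D)`_j) *m M^T); last by rewrite c0 mul0mx.
    rewrite mulmx_suml; apply: eq_bigr => j _; rewrite -scalemxAl (tnth_nth 0).
    by rewrite (nth_map 0) ?size_tuple //= -mulmxA MM mulmx1.
  by move/(congr1 (coord D i)); rewrite coord_basis_sum // linear0.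
- rewrite -[a]mulmx1 -MTM mulmxA -mulNmx.
  by rewrite !(cone_mx D _ MM); exact/Dpos/MTP.
Qed.

(** The element of the Weyl group is built by induction on the number of
    positive roots of [D] that are not positive for [D'].  If there are some,
    then a member [s] of [D] is one of them, and the reflection in [s] makes
    [s] negative and permutes the other positive roots of [D]. *)
Lemma bases_conjugate D D' : is_basis Phi D -> is_basis Phi D' ->
  exists2 M, root_isometry M & forall x, cone D x <-> cone D' (x *m M).
Proof.
move=> bD bD'; have [D'P bD'f D'pos] := bD'.
pose wrong D := [fset a in Phi | `[< cone D a /\ ~ cone D' a >]]%fset.
have [n] := ubnP #|` wrong D|; elim: n => // n IH in D bD *; rewrite ltnS => len.
have [DP bDf Dpos] := bD.
(* If every member of [D] is positive for [D'], then the two cones agree: a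
   member of [D'] cannot be negative for [D]. *)
have [[i iD']|Dsub] := pselect (exists i, ~ cone D' (tnth D i)); last first.
  have {}Dsub i : cone D' (tnth D i) by apply: contrapT => ?; apply: Dsub; exists i.
  exists 1%:M; first by split=> [|a|a]; rewrite ?trmx1 mulmx1.
  have sub x : cone D x -> cone D' x.
    move=> /(coneP _ bDf) xn; apply/(coneP _ bD'f) => j.
    rewrite (basis_coordE x bDf) linear_sum /= rpred_sum // => i _.
    by rewrite linearZ rpredM //=; have /(coneP _ bD'f) := Dsub i.
  move=> x; rewrite mulmx1; split=> [/sub//|/(coneP _ bD'f) xn].
  have D'D j : cone D (tnth D' j).
    have jP : tnth D' j \in Phi by exact/D'P/mem_tnth.
    have [//|/sub neg] := Dpos _ jP.
    move/(coneP _ bD'f)/(_ j)/natr_ge0: neg.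
    by rewrite linearN /= coord_tnth // eqxx oppr_ge0 ler10.
  apply/(coneP _ bDf) => i.
  rewrite (basis_coordE x bD'f) linear_sum /= rpred_sum // => j _.
  by rewrite linearZ rpredM //=; have /(coneP _ bDf) := D'D j.
have iP : tnth D i \in Phi by exact/DP/mem_tnth.
set s := tnth D i in iP iD'; have ss0 := dot_root_neq0 rsPhi iP.
have isoS := root_isometry_refl iP; have [SS SP _] := isoS.
pose S := reflection_mx s; pose D1 := [tuple of map (mulmxr S) D].
have S2 x : x *m S *m S = x.
  by rewrite -mulmxA -{2}[S]tr_reflection_mx SS mulmx1.
have bD1 : is_basis Phi D1 by exact: is_basis_mx.
have coneD1 x : cone D1 x <-> cone D (x *m S).
  by rewrite -{1}[x]S2; exact: cone_mx.
have sD : cone D s.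
  by apply/(coneP _ bDf) => j; rewrite coord_tnth // natr_nat.
have [|M isoM coneM] := IH D1 bD1.
  apply: leq_trans len; apply: fproper_ltn_card; rewrite fproperE; apply/andP; split.
    apply/fsubsetP => a.
    (* The only new positive root is [- s], which is positive for [D']. *)
    rewrite !inE /= => /andP[aP /asboolP[/coneD1 aD aD']]; rewrite aP /=.
    apply/asboolP; split=> //; have [aS|aS] := eqVneq (a *m S) s.
      have aE : a = - s by rewrite -[a]S2 aS mul_reflection_mx reflection_opp.
      by case: aD'; rewrite aE; have [] := D'pos _ iP.
    by rewrite -[a]S2 mul_reflection_mx; apply: reflection_positive => //; exact: SP.
  apply/fsubsetP => /(_ s); rewrite !inE /= iP /= => /(_ _)/asboolP-[].
    by apply/asboolP.
  move=> /coneD1 + _.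
  rewrite mul_reflection_mx reflection_opp // => /(coneP _ bDf)/(_ i)/natr_ge0.
  by rewrite linearN /= coord_tnth // eqxx oppr_ge0 ler10.
exists (S *m M); first exact: root_isometryM.
by move=> x; rewrite mulmxA -coneM coneD1 S2.
Qed.

End RootSystem.
End Weyl.

(** * Signs for the lift of an isometry *)

Record symmetric_cocycle (A L : zmodType) (c : L -> L -> A) : Prop := {
  cocycleC : forall x y, c x y = c y x;
  cocycleA : forall x y z, c x y + c (x + y) z = c y z + c x (y + z);
  cocycle0 : forall x, c 0 x = 0
}.

(** The abelian extension of [L] by [A] with cocycle [c]; it is a group only
    because [c] satisfies the cocycle laws, so the proof is a parameter. *)
Definition extension (A L : zmodType) (c : L -> L -> A)
  (hc : symmetric_cocycle c) : Type := (A * L)%type.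

Section Extension.
Variables (A L : zmodType) (c : L -> L -> A) (hc : symmetric_cocycle c).
Local Notation E := (extension hc).

Definition ext_add (u v : E) : E := (u.1 + v.1 + c u.2 v.2, u.2 + v.2).
Definition ext_zero : E := (0, 0).
Definition ext_opp (u : E) : E := (- u.1 - c (- u.2) u.2, - u.2).

Lemma ext_addA : associative ext_add.
Proof.
move=> [a x] [b y] [d z]; rewrite /ext_add /=; congr (_, _); last exact: addrA.
rewrite -!addrA; congr (_ + (_ + _)).
by rewrite [c x y + _]addrCA (cocycleA hc).
Qed.

Lemma ext_addC : commutative ext_add.
Proof.
move=> [a x] [b y]; rewrite /ext_add /= (cocycleC hc); congr (_, _).
  by rewrite [a + b]addrC.
exact: addrC.
Qed.

Lemma ext_add0 : left_id ext_zero ext_add.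
Proof. by move=> [a x]; rewrite /ext_add /= (cocycle0 hc) addr0 !add0r. Qed.

Lemma ext_addN : left_inverse ext_zero ext_opp ext_add.
Proof.
by move=> [a x]; rewrite /ext_add /ext_opp /= addrAC subrK !addNr.
Qed.

HB.instance Definition _ := Choice.copy E (A * L)%type.
HB.instance Definition _ :=
  GRing.isZmodule.Build E ext_addA ext_addC ext_add0 ext_addN.

Definition ext_proj (u : E) : L := u.2.

Lemma ext_proj_is_additive : zmod_morphism ext_proj.
Proof. by []. Qed.

HB.instance Definition _ :=
  GRing.isZmodMorphism.Build E L ext_proj ext_proj_is_additive.

(** On a free abelian group the extension splits: a basis can be lifted
    arbitrarily.  The defect of the first component of the splitting from
    being additive is the cocycle. *)
Lemma symmetric_cocycle_coboundary (I : finType) (b : I -> L)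
    (n : I -> {additive L -> int}) :
  (forall x, x = \sum_i b i *~ n i x) ->
  exists u : L -> A, forall x y, u (x + y) = u x + u y + c x y.
Proof.
move=> nE; pose phi x : E := \sum_i ((0, b i) : E) *~ n i x.
have phi2 x : ext_proj (phi x) = x.
  by rewrite [in RHS](nE x) raddf_sum; apply: eq_bigr => i _; rewrite raddfMz.
exists (fun x => (phi x).1) => x y.
have -> : phi (x + y) = phi x + phi y.
  by rewrite -big_split; apply: eq_bigr => i _; rewrite raddfD mulrzDr.
by rewrite -{3}(phi2 x) -{3}(phi2 y).
Qed.
End Extension.

Section RootLattice.
Variables (R : realType) (r : nat) (Phi : {fset 'rV[R]_r}).
Hypothesis rsPhi : is_root_system Phi.
Local Notation Q := (lattice (root_lattice Phi)).

Lemma root_lattice_ind (P : 'rV[R]_r -> Prop) :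
  P 0 -> (forall x y, P x -> P y -> P (x + y)) -> (forall x, P x -> P (- x)) ->
  (forall a, a \in Phi -> P a) -> forall x, x \in root_lattice Phi -> P x.
Proof.
move=> P0 PD PN PPhi x /asboolP[n ->]; rewrite big_seq.
elim/big_ind: _ => // a aP.
have Pn k : P (a *+ k).
  by elim: k => [|k IH]; rewrite ?mulr0n // mulrS; apply: PD => //; exact: PPhi.
by case: (n a) => k; [exact: Pn | rewrite NegzE mulrNz; apply/PN/Pn].
Qed.

Lemma root_in_lattice a : a \in Phi -> a \in root_lattice Phi.
Proof.
move=> aP; apply/asboolP; exists (fun b => (b == a)%:R).
rewrite (big_fsetD1 a) //= eqxx mulr1z big1_fset ?addr0 // => b.
by rewrite !inE => /andP[/negPf -> _].
Qed.

Lemma root_lattice_mx (M : 'M[R]_r) (x : 'rV[R]_r) :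
  (forall a, a \in Phi -> a *m M \in Phi) ->
  x \in root_lattice Phi -> x *m M \in root_lattice Phi.
Proof.
move=> MP; move: x; apply: root_lattice_ind => [|x y xP yP|x xP|a aP].
- by rewrite mul0mx rpred0.
- by rewrite mulmxDl rpredD.
- by rewrite mulNmx rpredN.
- exact/root_in_lattice/MP.
Qed.

Definition lattice_mx (M : 'M[R]_r) (MP : forall a, a \in Phi -> a *m M \in Phi)
  (x : Q) : Q := exist _ (\val x *m M) (root_lattice_mx MP (valP x)).

Lemma dot_int x y : (forall a, a \in Phi -> dot a a = 2) ->
  x \in root_lattice Phi -> y \in root_lattice Phi -> dot x y \is a Num.int.
Proof.
move=> norm2 + yQ; move: x; have [_ _ _ _ Pint] := rsPhi.
have dotN u v : dot (- u) v = - dot u v :> R by rewrite -scaleN1r dotZl mulN1r.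
have dot0 v : dot 0 v = 0 :> R by rewrite -(scale0r 0) dotZl mul0r.
apply: root_lattice_ind => [|u v uy vy|u uy|a aP].
- by rewrite dot0 rpred0.
- by rewrite dotDl rpredD.
- by rewrite dotN rpredN.
rewrite dotC; move: y yQ; apply: root_lattice_ind => [|u v uy vy|u uy|b bP].
- by rewrite dot0 rpred0.
- by rewrite dotDl rpredD.
- by rewrite dotN rpredN.
have := Pint a b aP bP; rewrite norm2 // mulrAC divff ?mul1r //.
by rewrite pnatr_eq0.
Qed.

Section Coordinates.
Variables (D : r.-tuple 'rV[R]_r) (bD : is_basis Phi D).

Lemma coord_int i (x : Q) : coord D i (\val x) \is a Num.int.
Proof.
have [_ bDf Dpos] := bD; case: x => x /=; move: x.
apply: root_lattice_ind => [|x y xi yi|x xi|a aP].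
- by rewrite linear0 rpred0.
- by rewrite linearD rpredD.
- by rewrite linearN rpredN.
have [|] := Dpos _ aP => /(coneP _ bDf)/(_ i)/intr_nat //.
by rewrite linearN rpredN.
Qed.

(** The coordinates are real numbers in the ambient space; on the root lattice
    rounding down loses nothing and makes them integers by type. *)
Definition int_coord i (x : Q) : int := Num.floor (coord D i (\val x)).

Lemma int_coordK i x : (int_coord i x)%:~R = coord D i (\val x).
Proof. by rewrite floorK ?coord_int. Qed.

Lemma int_coord_is_additive i : zmod_morphism (int_coord i).
Proof.
move=> x y; apply: (@intr_inj R).
by rewrite rmorphB /= !int_coordK !raddfB.
Qed.

HB.instance Definition _ i :=
  GRing.isZmodMorphism.Build Q int (int_coord i) (int_coord_is_additive i).

Lemma root_lattice_cocycle_coboundary (A : zmodType) (c : Q -> Q -> A) :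
  symmetric_cocycle c ->
  exists u : Q -> A, forall x y, u (x + y) = u x + u y + c x y.
Proof.
move=> hc; have [DP bDf Dpos] := bD.
pose b i : Q := exist _ (tnth D i) (root_in_lattice (DP _ (mem_tnth i D))).
apply: (symmetric_cocycle_coboundary hc (b := b) (n := fun i => int_coord i)).
move=> x; apply/val_inj; rewrite {1}(basis_coordE (\val x) bDf).
rewrite raddf_sum; apply: eq_bigr => i _.
by rewrite raddfMz /= -int_coordK scaler_int.
Qed.

End Coordinates.

(** The quotient of [eps] by its pullback along an isometry is symmetric,
    because both have the commutator [(-1) ^ (x|y)]; so it is a coboundary.  The
    signs are written additively, as booleans. *)
Lemma cocycle_lift (norm2 : forall a, a \in Phi -> dot a a = 2) D
    (bD : is_basis Phi D) (eps : Q -> Q -> int) (heps : is_cocycle eps)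
    (w : Q -> Q) (wD : forall x y, w (x + y) = w x + w y)
    (wdot : forall x y, dot (\val (w x)) (\val (w y)) = dot (\val x) (\val y)) :
  exists u : Q -> bool, forall x y,
    eps x y * (-1) ^+ u (x + y) = (-1) ^+ u x * (-1) ^+ u y * eps (w x) (w y).
Proof.
have [eps1 epsA epsC eps0] := heps.
pose s x y := eps x y == -1.
have sE x y : eps x y = (-1) ^+ s x y.
  by rewrite /s; case: (eps1 x y) => ->.
have sA x y z : s x y + s (x + y) z = s y z + s x (y + z).
  apply: (@signr_inj int); rewrite /= !signr_addb -!sE; exact: epsA.
have sC x y : s (w x) (w y) + s (w y) (w x) = s x y + s y x.
  apply: (@signr_inj int); rewrite /= !signr_addb -!sE.
  have /intrP[k xyk] := dot_int norm2 (valP x) (valP y).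
  by rewrite (epsC x y k) ?(epsC (w x) (w y) k) // wdot.
have w0 : w 0 = 0 by apply: (addrI (w 0)); rewrite -wD !addr0.
have hc : symmetric_cocycle (fun x y => s (w x) (w y) + s x y).
  split=> [x y|x y z|x].
  - by move: (sC x y); case: (s (w x) _) (s x y) (s (w y) _) (s y x) => [] [] [] [].
  - by rewrite !wD addrACA sA sA [RHS]addrACA.
  - by rewrite w0 /s !(eps0 _).1.
have [u uP] := root_lattice_cocycle_coboundary bD hc.
exists u => x y; rewrite uP !sE -!signr_addb; congr (_ ^+ nat_of_bool _).
by rewrite -addrA addrCA; case: (s x y) (u x) (u y) (s (w x) _) => [] [] [] [].
Qed.
End RootLattice.

(** * Fields and normally ordered products *)

(** The sums over all powers of [z] are computed by truncation; stating each
    truncation for all large bounds lets several of them share one bound. *)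
Definition for_large (P : nat -> Prop) : Prop :=
  exists K0, forall K, (K0 <= K)%N -> P K.

Lemma for_large_and P Q : for_large P -> for_large Q ->
  for_large (fun K => P K /\ Q K).
Proof.
move=> [k Pk] [l Ql]; exists (maxn k l) => K; rewrite geq_max => /andP[kK lK].
by split; [exact: Pk | exact: Ql].
Qed.

Lemma for_large_ltn n (P : nat -> nat -> Prop) :
  (forall i, for_large (P i)) -> for_large (fun K => forall i, (i < n)%N -> P i K).
Proof.
move=> /choice[k Pk]; exists (\max_(i < n) k i) => K nK i i_n; apply: Pk.
by apply: leq_trans nK; rewrite (leq_bigmax (Ordinal i_n)).
Qed.

Lemma for_large_ex P : for_large P -> exists K, P K.
Proof. by move=> [k Pk]; exists k; exact: Pk. Qed.

Section FiniteSums.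
Variables (V : zmodType) (G : int -> V) (K : nat).

Lemma fsum_nonneg : (forall i, (K <= i)%N -> G (Posz i) = 0) ->
  \sum_(i \in [set i : int | 0 <= i]) G i = \sum_(k < K) G (Posz k).
Proof.
move=> G0; rewrite (reindex_fsbig Posz setT); last first.
  split=> [k _ //|k l _ _ [] //|[k|k] //= _]; by exists k.
rewrite (fsbig_ord _ _ (fun k => G (Posz k))); apply/esym/fsbig_widen => // k [_ /= kK].
by apply: G0; rewrite leqNgt; exact/negP.
Qed.

Lemma fsum_neg : (forall i, (K <= i)%N -> G (Negz i) = 0) ->
  \sum_(i \in [set i : int | i < 0]) G i = \sum_(k < K) G (Negz k).
Proof.
move=> G0; rewrite (reindex_fsbig Negz setT); last first.
  split=> [k _ //|k l _ _ [] //|[k|k] //= _]; by exists k.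
rewrite (fsbig_ord _ _ (fun k => G (Negz k))); apply/esym/fsbig_widen => // k [_ /= kK].
by apply: G0; rewrite leqNgt; exact/negP.
Qed.
End FiniteSums.

Section Fields.
Variables (F : fieldType) (V : lmodType F).
Implicit Types (A B : field V) (v : V) (N : int).

(** The power series of a field applied to a vector have only finitely many
    negative powers. *)
Definition is_field A : Prop :=
  (forall N, linear (A N)) /\
  forall v, for_large (fun K => forall N, N < - K%:Z -> A N v = 0).

Lemma field_linear A N : is_field A -> exists f : {linear V -> V}, A N = f.
Proof.
move=> [Alin _].
pose f := GRing.isLinear.Build F V V *:%R (A N) (Alin N).
by exists (HB.pack_for {linear V -> V} (A N) f).
Qed.

Lemma field0 A N : is_field A -> A N 0 = 0.
Proof. by move/(field_linear N) => [f ->]; exact: linear0. Qed.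

Lemma fieldD A N u v : is_field A -> A N (u + v) = A N u + A N v.
Proof. by move/(field_linear N) => [f ->]; exact: linearD. Qed.

Lemma fieldZ A N c v : is_field A -> A N (c *: v) = c *: A N v.
Proof. by move/(field_linear N) => [f ->]; exact: linearZ. Qed.

Lemma field_sum A N I (r : seq I) P (f : I -> V) : is_field A ->
  A N (\sum_(i <- r | P i) f i) = \sum_(i <- r | P i) A N (f i).
Proof. by move/(field_linear N) => [g ->]; exact: linear_sum. Qed.

Lemma is_field0 : is_field (fun _ _ => 0).
Proof. by split=> [N c u v|v]; [rewrite scaler0 addr0 | exists 0%N]. Qed.

Lemma is_field_comb c A B : is_field A -> is_field B ->
  is_field (fun N v => c *: A N v + B N v).
Proof.
move=> Af Bf; split=> [N d u v|v].
  rewrite !fieldD // !fieldZ // !scalerDr !scalerA [c * d]mulrC -!addrA.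
  by congr (_ + _); rewrite addrCA.
have [k kP] := for_large_and (Af.2 v) (Bf.2 v); exists k => K kK N NK.
by have [-> // ->] := kP K kK; rewrite ?scaler0 ?addr0.
Qed.

Definition normal_product_trunc K A B N v : V :=
  \sum_(k < K) A (Posz k) (B (N - Posz k) v) +
  \sum_(k < K) B (N - Negz k) (A (Negz k) v).

(** The truncation works for all smaller powers of [z] at once, because these
    involve fewer of the modes of [B] that do not kill [v]. *)
Lemma normal_product_large A B N v : is_field A -> is_field B ->
  for_large (fun K => forall M : int, M <= N ->
    normal_product A B M v = normal_product_trunc K A B M v).
Proof.
move=> Af Bf; have [a aP] := Af.2 v; have [b bP] := Bf.2 v.
exists (a + b + `|N|)%N.+1 => K abK M MN.
rewrite /normal_product /normal_product_trunc; apply: (f_equal2 +%R).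
  apply: fsum_nonneg => i Ki; rewrite (bP b) ?field0 //; lia.
apply: fsum_neg => i Ki; rewrite (aP a) ?field0 //; lia.
Qed.

Lemma normal_product_field A B : is_field A -> is_field B ->
  is_field (normal_product A B).
Proof.
move=> Af Bf; split=> [N c u v|v].
  have [K [uE [vE wE]]] := for_large_ex (for_large_and
    (normal_product_large N u Af Bf) (for_large_and
    (normal_product_large N v Af Bf) (normal_product_large N (c *: u + v) Af Bf))).
  rewrite uE // vE // wE // /normal_product_trunc scalerDr !scaler_sumr addrACA.
  rewrite -!big_split; apply: eq_bigr => k _ /=.
  by rewrite !(fieldD _ _ _ Bf, fieldZ _ _ _ Bf, fieldD _ _ _ Af, fieldZ _ _ _ Af).
have [a aP] := Af.2 v; have [b bP] := Bf.2 v.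
have [c cP] := for_large_ltn a (fun i => Bf.2 (A (Negz i) v)).
exists (a + b + c)%N => K0 K0P N NK.
have [K KE] := for_large_ex (normal_product_large N v Af Bf).
rewrite KE // /normal_product_trunc !big1 ?addr0 // => -[i /= _] _.
  have [ia|ai] := ltnP i a; last by rewrite (aP a) ?field0 //; lia.
  by rewrite (cP c _ i ia) //; lia.
by rewrite (bP b) ?field0 //; lia.
Qed.

Lemma normal_product_linearr c A B1 B2 N v :
  is_field A -> is_field B1 -> is_field B2 ->
  normal_product A (fun N v => c *: B1 N v + B2 N v) N v =
  c *: normal_product A B1 N v + normal_product A B2 N v.
Proof.
move=> Af B1f B2f; have Bf := is_field_comb c B1f B2f.
have [K [uE [vE wE]]] := for_large_ex (for_large_and
  (normal_product_large N v Af B1f) (for_large_and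
  (normal_product_large N v Af B2f) (normal_product_large N v Af Bf))).
rewrite uE // vE // wE // /normal_product_trunc scalerDr !scaler_sumr addrACA.
rewrite -!big_split; apply: eq_bigr => k _ /=.
by rewrite fieldD // fieldZ.
Qed.

Lemma normal_product_linearl c A1 A2 B N v :
  is_field A1 -> is_field A2 -> is_field B ->
  normal_product (fun N v => c *: A1 N v + A2 N v) B N v =
  c *: normal_product A1 B N v + normal_product A2 B N v.
Proof.
move=> A1f A2f Bf; have Af := is_field_comb c A1f A2f.
have [K [uE [vE wE]]] := for_large_ex (for_large_and
  (normal_product_large N v A1f Bf) (for_large_and
  (normal_product_large N v A2f Bf) (normal_product_large N v Af Bf))).
rewrite uE // vE // wE // /normal_product_trunc scalerDr !scaler_sumr addrACA.
rewrite -!big_split; apply: eq_bigr => k _ /=.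
by rewrite fieldD // fieldZ.
Qed.

Lemma normal_product0l A B N v :
  (forall N v, A N v = 0) -> is_field B -> normal_product A B N v = 0.
Proof.
move=> A0 Bf; rewrite /normal_product !fsbig1 ?addr0 // => i _; rewrite A0 //.
exact: field0.
Qed.

Lemma normal_product0r A N v :
  is_field A -> normal_product A (fun _ _ => 0) N v = 0.
Proof.
by move=> Af; rewrite /normal_product !fsbig1 ?addr0 // => i _; exact: field0.
Qed.

(** The four parts of a product of three fields, according to the signs of the
    powers of [z] taken from the first two. *)
Definition normal_product2_trunc K A A' B N v : V :=
  (\sum_(i < K) \sum_(j < K) A (Posz i) (A' (Posz j) (B (N - Posz i - Posz j) v)) +
   \sum_(i < K) \sum_(j < K) A (Posz i) (B (N - Posz i - Negz j) (A' (Negz j) v))) +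
  (\sum_(i < K) \sum_(j < K) A' (Posz j) (B (N - Negz i - Posz j) (A (Negz i) v)) +
   \sum_(i < K) \sum_(j < K) B (N - Negz i - Negz j) (A' (Negz j) (A (Negz i) v))).

Lemma normal_product2_large A A' B N v :
  is_field A -> is_field A' -> is_field B ->
  for_large (fun K => normal_product A (normal_product A' B) N v =
                      normal_product2_trunc K A A' B N v).
Proof.
move=> Af A'f Bf; have A'Bf := normal_product_field A'f Bf.
have [a aP] := Af.2 v.
have [k kP] := for_large_and (normal_product_large N v Af A'Bf) (for_large_and
  (normal_product_large N v A'f Bf)
  (for_large_ltn a (fun i =>
     normal_product_large (N - Negz i) (A (Negz i) v) A'f Bf))).
exists k => K /kP[-> // [E1 E2]]; rewrite /normal_product2_trunc; congr (_ + _).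
  rewrite -big_split; apply: eq_bigr => i _ /=; rewrite E1 ?fieldD ?field_sum //.
  lia.
rewrite -big_split; apply: eq_bigr => i _ /=.
have [ia|ai] := ltnP i a; first by rewrite E2 // ?addrA.
(* The truncation of the inner product is not uniform in the vector, but these
   vectors are zero. *)
rewrite (aP a) //; last by lia.
by rewrite field0 // !big1 ?addr0 // => j _; rewrite !field0.
Qed.

(** Both sides put the terms of [A] and [A'] with nonnegative powers of [z] to
    the left of [B] and those with negative powers to the right, so that only
    terms of the same kind change places. *)
Lemma normal_productCA A A' B N v :
  is_field A -> is_field A' -> is_field B ->
  (forall i j w, A (Posz i) (A' (Posz j) w) = A' (Posz j) (A (Posz i) w)) ->
  (forall i j w, A (Negz i) (A' (Negz j) w) = A' (Negz j) (A (Negz i) w)) ->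
  normal_product A (normal_product A' B) N v =
  normal_product A' (normal_product A B) N v.
Proof.
move=> Af A'f Bf Cpos Cneg.
have [K [-> ->]] := for_large_ex (for_large_and
  (normal_product2_large N v Af A'f Bf) (normal_product2_large N v A'f Af Bf)).
rewrite /normal_product2_trunc.
rewrite [X in _ = (X + _) + _]exchange_big [X in _ = (_ + X) + _]exchange_big /=.
rewrite [X in _ = _ + (X + _)]exchange_big [X in _ = _ + (_ + X)]exchange_big /=.
rewrite [RHS]addrACA.
congr (_ + _ + (_ + _)); apply: eq_bigr => i _; apply: eq_bigr => j _.
- by rewrite Cpos addrAC.
- by rewrite addrAC.
- by rewrite addrAC.
- by rewrite Cneg addrAC.
Qed.

Lemma iter_fderivE n A N v :
  iter n (@fderiv _ _) A N v =
  (\prod_(k < n) (N + Posz k + 1))%:~R *: A (N + Posz n) v.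
Proof.
elim: n N => [|n IH] N; first by rewrite big_ord0 scale1r addr0.
rewrite iterS /fderiv IH scalerA -intrM; congr (_%:~R *: A _ v); last by lia.
by rewrite big_ord_recl addr0; congr (_ * _); apply: eq_bigr => k _; rewrite lift0; lia.
Qed.

Lemma fderiv_divE n A N v :
  fderiv_div n A N v =
  ((n`!%:R)^-1 * (\prod_(k < n) (N + Posz k + 1))%:~R) *: A (N + Posz n) v.
Proof. by rewrite /fderiv_div iter_fderivE scalerA. Qed.

Lemma fderiv_div_field n A : is_field A -> is_field (fderiv_div n A).
Proof.
move=> Af; split=> [N c u v|v].
  rewrite !fderiv_divE fieldD // fieldZ // scalerDr !scalerA.
  by rewrite [_ * c]mulrC.
have [a aP] := Af.2 v; exists (a + n)%N => K aK N NK.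
by rewrite fderiv_divE (aP a) ?scaler0 //; lia.
Qed.

Lemma fderiv_div_comb n c A B N v :
  fderiv_div n (fun N v => c *: A N v + B N v) N v =
  c *: fderiv_div n A N v + fderiv_div n B N v.
Proof. by rewrite !fderiv_divE scalerDr !scalerA [_ * c]mulrC. Qed.

End Fields.

Section Intertwine.
Variables (F : fieldType) (V W : lmodType F) (g : {linear V -> W}).

Lemma normal_product_intertwine (A B : field V) (A' B' : field W) :
  is_field A -> is_field B -> is_field A' -> is_field B' ->
  (forall N v, g (A N v) = A' N (g v)) ->
  (forall N v, g (B N v) = B' N (g v)) ->
  forall N v, g (normal_product A B N v) = normal_product A' B' N (g v).
Proof.
move=> Af Bf A'f B'f gA gB N v.
have [K [-> // -> //]] := for_large_ex (for_large_and
  (normal_product_large N v Af Bf) (normal_product_large N (g v) A'f B'f)).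
rewrite linearD !linear_sum; congr (_ + _); apply: eq_bigr => k _.
  by rewrite gA gB.
by rewrite gB gA.
Qed.

Lemma fderiv_div_intertwine n (A : field V) (A' : field W) :
  (forall N v, g (A N v) = A' N (g v)) ->
  forall N v, g (fderiv_div n A N v) = fderiv_div n A' N (g v).
Proof. by move=> gA N v; rewrite !fderiv_divE linearZ /= gA. Qed.

End Intertwine.

(** * The Heisenberg modules and lifts of isometries *)

Section Fock.
Variables (R : realType) (r : nat) (L : zmodClosed 'rV[R]_r).
Local Notation C := R[i]%C.
Local Notation V := (VL L).
Local Notation h := 'rV[C]_r.
Implicit Types (v : V) (x y : h) (b : basis_index L) (S : set (basis_index L)).

(** The sums of some of the M(1,beta) and the subspaces of vectors of bounded
    degree are all of this form. *)
Definition supported S v : Prop := forall b, ~ S b -> mcoeff b v = 0.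

Lemma supported_comb S c u v :
  supported S u -> supported S v -> supported S (c *: u + v).
Proof.
by move=> uS vS b bS; rewrite mcoeffD mcoeffZ uS // vS // mulr0 addr0.
Qed.

Lemma supported0 S : supported S 0.
Proof. by move=> b _; rewrite mcoeff0. Qed.

Lemma supportedZ S c v : supported S v -> supported S (c *: v).
Proof. by move=> vS; rewrite -[_ *: v]addr0; exact/supported_comb/supported0. Qed.

Lemma supported_sum S I (s : seq I) (P : pred I) (f : I -> V) :
  (forall i, P i -> supported S (f i)) -> supported S (\sum_(i <- s | P i) f i).
Proof.
move=> fS; elim/big_ind: _ => [|u v uS vS|//]; first exact: supported0.
by rewrite -[u]scale1r; exact: supported_comb.
Qed.

Lemma supported_sub S S' v : S `<=` S' -> supported S v -> supported S' v.
Proof. by move=> SS' vS b bS'; apply: vS => /SS'. Qed.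

Lemma supported_basis S b : S b -> supported S (basis_vector b).
Proof.
move=> Sb k nSk; rewrite /basis_vector mcoeffU; case: eqP => // bk.
by case: nSk; rewrite -bk.
Qed.

Opaque basis_vector linext.

Lemma supported_ind S (P : V -> Prop) :
  P 0 -> (forall c u v, P u -> P v -> P (c *: u + v)) ->
  (forall b, S b -> P (basis_vector b)) -> forall v, supported S v -> P v.
Proof.
move=> P0 PC Pb v vS.
have <- : linext (@basis_vector R r L) v = v.
  apply: (@VL_ext _ _ _ _ (linext (@basis_vector R r L)) idfun) => b.
  exact: linext_basis.
rewrite (@linext_sub _ _ _ _ _ v (msupp v)) // big_seq.
elim/big_rec: _ => // b u bv Pu; apply: PC => //; apply: Pb.
apply: contrapT => /vS v0; move: bv.
by rewrite -mcoeff_neq0 v0 eqxx.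
Qed.

Lemma supportedT v : supported setT v.
Proof. by move=> b []. Qed.

Lemma supported_linear S S' (f : {linear V -> V}) v :
  (forall b, S b -> supported S' (f (basis_vector b))) ->
  supported S v -> supported S' (f v).
Proof.
move=> fS; move: v; apply: supported_ind => // [|c u v uS vS].
  by rewrite linear0; exact: supported0.
by rewrite linearP; exact: supported_comb.
Qed.

(** By the PBW theorem, which is built into the choice of the basis, the vectors
    e^beta generate V_L under the creation operators. *)
Lemma fock_ind (P : V -> Prop) :
  P 0 -> (forall c u v, P u -> P v -> P (c *: u + v)) ->
  (forall beta, P (exp_vector beta)) ->
  (forall i n v, P v -> P (heis (ubasis R i) (Negz n) v)) -> forall v, P v.
Proof.
move=> P0 PC Pexp Pheis v; apply: (supported_ind P0 PC _ (supportedT v)) => b _.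
by rewrite basis_vectorE; elim: (enum_mset b.1) => [|p s IH] /=; auto.
Qed.

Lemma fock_ext (W : lmodType C) (f g : {linear V -> W})
    (H : 'I_r -> nat -> W -> W) :
  (forall beta, f (exp_vector beta) = g (exp_vector beta)) ->
  (forall i n v, f (heis (ubasis R i) (Negz n) v) = H i n (f v)) ->
  (forall i n v, g (heis (ubasis R i) (Negz n) v) = H i n (g v)) -> f =1 g.
Proof.
move=> fgexp fH gH; apply: fock_ind => // [|c u v fgu fgv|i n v fgv].
- by rewrite !linear0.
- by rewrite !linearP fgu fgv.
- by rewrite fH gH fgv.
Qed.

Lemma heisE x m v : heis x m v = \sum_i x 0 i *: heis (ubasis R i) m v.
Proof.
rewrite {1}/heis; apply: eq_bigr => i _; congr (_ *: _); move: v.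
apply: (@VL_ext _ _ _ _ (linext (heis_basis i m)) (heis (ubasis R i) m)) => b.
by rewrite /= linext_basis heis_ubasis.
Qed.

Lemma heis_linearl m v : linear (fun x => heis x m v : V).
Proof.
move=> c x y; rewrite /heis scaler_sumr -big_split; apply: eq_bigr => i _ /=.
by rewrite !mxE scalerDl scalerA.
Qed.

Lemma heisZ x m c v : heis x m (c *: v) = c *: heis x m v.
Proof. exact: linearZ. Qed.

Lemma heis0l m v : heis 0 m v = 0 :> V.
Proof. by rewrite /heis big1 // => i _; rewrite mxE scale0r. Qed.

(** The commutator is [m (x|y)] when [m + n = 0], so that it vanishes if [m] and
    [n] are both negative or both nonnegative. *)
Lemma heis_commute x y m n v : (m + n == 0) ==> (m == 0) ->
  heis x m (heis y n v) = heis y n (heis x m v) :> V.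
Proof.
move=> mn; apply/eqP; rewrite -subr_eq0 heis_comm; move: mn.
by case: eqP => [_ /eqP ->|_ _]; rewrite ?mulr0z ?mulr0 ?mul0r scale0r.
Qed.

Section Lift.
Variables (M : 'M[R]_r) (w : lattice L -> lattice L) (u : lattice L -> C).
Hypothesis MM : M *m M^T = 1%:M.
Hypothesis wM : forall alpha, \val (w alpha) = \val alpha *m M.
Local Notation Mc := (map_mx (real_complex R) M).

Lemma to_h_isometry alpha : to_h (w alpha) = to_h alpha *m Mc.
Proof. by rewrite /to_h wM map_mxM. Qed.

Lemma Mc_orthogonal : Mc *m Mc^T = 1%:M.
Proof. by rewrite map_trmx -map_mxM MM map_mx1. Qed.

Lemma supported_heis x m beta v :
  supported (fun b => b.2 = beta) v ->
  supported (fun b => b.2 = beta) (heis x m v).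
Proof.
apply: supported_linear => -[A g] /= ->; rewrite heisE; apply: supported_sum => i _.
apply: supportedZ; rewrite heis_ubasis.
by case: m => [[|n]|n] /=; try apply: supportedZ; exact: supported_basis.
Qed.

(** On M(1,beta) the lift is given by the universal property of this induced
    module: the operators [(x M)(m)] satisfy the commutation relations of the
    [x(m)], and they act on [e^(w beta)] as the [x(m)] act on [e^beta]. *)
Lemma lift_exists : exists g : {linear V -> V},
  (forall beta, g (exp_vector beta) = u beta *: exp_vector (w beta)) /\
  (forall x m v, g (heis x m v) = heis (x *m Mc) m (g v)).
Proof.
have Hlinl m v : linear (fun x => heis (x *m Mc) m v : V).
  by move=> c x y; rewrite mulmxDl -scalemxAl; exact: heis_linearl.
have Hcomm x y m n v : heis (x *m Mc) m (heis (y *m Mc) n v) -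
    heis (y *m Mc) n (heis (x *m Mc) m v) =
    ((m + n == 0)%:R * m%:~R * dot x y) *: v :> V.
  by rewrite heis_comm dot_orthogonal ?Mc_orthogonal.
have H0 beta x : heis (x *m Mc) 0 (u beta *: exp_vector (w beta)) =
    dot x (to_h beta) *: (u beta *: exp_vector (w beta)) :> V.
  rewrite heisZ heis0_exp to_h_isometry dot_orthogonal; last exact: Mc_orthogonal.
  by rewrite scalerA mulrC -scalerA.
have Hpos beta x n : heis (x *m Mc) (Posz n.+1) (u beta *: exp_vector (w beta)) = 0 :> V.
  by rewrite heisZ heis_pos_exp scaler0.
have /choice[f fP] := fun beta => fock_induced
  (fun x m => @heis_is_linear R r L (x *m Mc) m) Hlinl Hcomm (H0 beta) (Hpos beta).
pose g : {linear V -> V} := linext (fun b => f b.2 (basis_vector b)).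
have g_basis b : g (basis_vector b) = f b.2 (basis_vector b) by exact: linext_basis.
have gf beta v : supported (fun b => b.2 = beta) v -> g v = f beta v.
  have [flin _ _] := fP beta.
  pose fl : {linear V -> V} := HB.pack_for {linear V -> V} (f beta)
    (GRing.isLinear.Build C V V *:%R (f beta) flin).
  rewrite -[f beta]/(fl : V -> V); move: v.
  apply: supported_ind => [|c v v' gv gv'|[A _] /= ->].
  - by rewrite !linear0.
  - by rewrite !linearP gv gv'.
  - exact: g_basis.
exists g; split=> [beta|x m v].
  have [_ fexp _] := fP beta; rewrite (gf beta); first exact: fexp.
  exact: supported_basis.
move: v; pose f1 : V -> V := g \o heis x m.
pose f2 : V -> V := heis (x *m Mc) m \o g.
apply: (@VL_ext _ _ _ _ f1 f2) => -[A beta]; rewrite /f1 /f2 /=.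
rewrite (gf beta); last exact/supported_heis/supported_basis.
rewrite (gf beta); last exact: supported_basis.
have [_ _ fheis] := fP beta; exact: fheis.
Qed.

Variable g : {linear V -> V}.
Hypothesis gexp : forall beta, g (exp_vector beta) = u beta *: exp_vector (w beta).
Hypothesis gheis : forall x m v, g (heis x m v) = heis (x *m Mc) m (g v).

Lemma lift_supported b :
  supported (fun b' => b'.2 = w b.2) (g (basis_vector b)).
Proof.
rewrite basis_vectorE; elim: (enum_mset b.1) => [|p s IH] /=.
  by rewrite gexp; exact/supportedZ/supported_basis.
by rewrite gheis; exact: supported_heis.
Qed.

Lemma lift_sub_lattice (A B : set (lattice L)) v :
  (forall beta, A beta -> B (w beta)) ->
  supported (fun b => A b.2) v -> supported (fun b => B b.2) (g v).
Proof.
move=> AB; apply: supported_linear => b Ab.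
by apply: supported_sub (lift_supported (b := b)) => b' /= ->; exact: AB.
Qed.

End Lift.

(** The weight of a basis vector, up to the constant [(beta|beta)/2] on M(1,beta).
    Since [h(n)] lowers it by [n], only finitely many products of the [h(n)]
    with [n > 0] do not kill a given vector. *)
Definition degree b : nat := \sum_(p <- enum_mset b.1) p.2.+1.

Lemma degree_del (A : {mset 'I_r * nat}%mset) beta i n : (i, n) \in A ->
  degree (A, beta) = (n.+1 + degree ((A `\ (i, n))%mset, beta))%N.
Proof.
move=> inA; rewrite /degree /=.
have E : perm_eq (enum_mset A) ((i, n) :: enum_mset (A `\ (i, n))%mset).
  apply/allP => q _; apply/eqP; rewrite /= !count_mem_mset msetE2 msetnE.
  case: (eqVneq q (i, n)) => [->|]; last by rewrite subn0.
  by rewrite subnKC // -in_mset.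
by rewrite (perm_big _ E) big_cons.
Qed.

Definition degree_lt d v := supported [set b | (degree b < d)%N] v.

Lemma degree_lt_exists v : exists d, degree_lt d v.
Proof.
apply: (supported_ind (P := fun v => exists d, degree_lt d v) _ _ _ (supportedT v))
  => [|c u u' [d du] [d' du']|b _].
- by exists 0%N; exact: supported0.
- exists (maxn d d'); apply: supported_comb; [move: du | move: du'];
    apply: supported_sub => b /= bd; apply: leq_trans bd _.
  + exact: leq_maxl.
  + exact: leq_maxr.
- by exists (degree b).+1; apply: supported_basis => /=.
Qed.

Lemma degree_lt_le d d' v : (d <= d')%N -> degree_lt d v -> degree_lt d' v.
Proof. by move=> dd'; apply: supported_sub => b /= bd; exact: leq_trans dd'. Qed.

Lemma degree_lt0 v : degree_lt 0 v -> v = 0.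
Proof. by move=> v0; apply/malgP => b; rewrite v0 ?mcoeff0. Qed.

Lemma degree_lt_heis x n d v :
  degree_lt d v -> degree_lt (d - n.+1) (heis x (Posz n.+1) v).
Proof.
apply: supported_linear => -[A beta] /= Ad; rewrite heisE.
apply: supported_sum => i _; apply: supportedZ; rewrite heis_ubasis /=.
have [inA|/mset_eq0P ->] := boolP ((i, n) \in (A : {mset 'I_r * nat}%mset)); last first.
  by rewrite muln0 scale0r; exact: supported0.
apply/supportedZ/supported_basis => /=.
by rewrite ltn_subRL -degree_del.
Qed.

Section Series.
Variable X : nat -> V -> V.

Lemma series_pow_linear k N : (forall n, linear (X n)) -> linear (series_pow X k N).
Proof.
move=> Xlin; elim: k N => [|k IH] N c u v /=.
  by case: ifP => // _; rewrite scaler0 addr0.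
by rewrite scaler_sumr -big_split; apply: eq_bigr => n _ /=; rewrite IH Xlin.
Qed.

Lemma series_exp_linear N : (forall n, linear (X n)) -> linear (series_exp X N).
Proof.
move=> Xlin c u v; rewrite /series_exp scaler_sumr -big_split.
apply: eq_bigr => k _ /=; rewrite series_pow_linear // scalerDr !scalerA.
by rewrite [_ * c]mulrC.
Qed.

Lemma degree_lt_series_exp N d v :
  (forall n e u, (0 < n)%N -> degree_lt e u -> degree_lt (e - n) (X n u)) ->
  degree_lt d v -> degree_lt (d - N) (series_exp X N v).
Proof.
move=> Xlow vd; apply: supported_sum => -[k /= _] _.
apply: supportedZ; elim: k N => [|k IH] N /=.
  by case: eqP => [->|_]; [rewrite subn0 | exact: supported0].
rewrite big_seq; apply: supported_sum => n; rewrite mem_index_iota ltnS.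
move=> /andP[n0 nN].
have -> : (d - N = d - (N - n) - n)%N by lia.
by apply: Xlow => //; exact: IH.
Qed.
End Series.

Lemma series_exp_intertwine (g : {linear V -> V}) (X X' : nat -> V -> V) :
  (forall n v, (0 < n)%N -> g (X n v) = X' n (g v)) ->
  forall N v, g (series_exp X N v) = series_exp X' N (g v).
Proof.
move=> gX N v; rewrite linear_sum; apply: eq_bigr => -[k /= _] _.
rewrite linearZ; congr (_ *: _); elim: k N => [|k IH] N /=.
  by case: ifP; rewrite ?linear0.
rewrite linear_sum !big_seq; apply: eq_bigr => n.
by rewrite mem_index_iota => /andP[n0 _]; rewrite gX // IH.
Qed.

Lemma current_field x : is_field (current x : field V).
Proof.
split=> [N|v]; first exact: heis_is_linear.
have [d dv] := degree_lt_exists v; exists d.+1 => K dK N NK; rewrite /current.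
have [n nE] : exists n : nat, - N - 1 = Posz n.+1 by exists (`|N|.-2); lia.
rewrite nE; apply: degree_lt0.
apply: (degree_lt_le _ (degree_lt_heis (n := n) x dv)); lia.
Qed.

End Fock.
Transparent basis_vector linext.

(** * The operators Y(e^alpha, z) *)

Section Vertex.
Variables (R : realType) (r : nat) (L : zmodClosed 'rV[R]_r).
Local Notation C := R[i]%C.
Local Notation V := (VL L).
Local Notation h := 'rV[C]_r.
Variable eps : lattice L -> lattice L -> int.
Implicit Types (v : V) (x y : h) (b : basis_index L) (alpha beta : lattice L).

Opaque basis_vector linext.

HB.instance Definition _ alpha :=
  GRing.isLinear.Build C V V *:%R (shift eps alpha)
    (@linext_is_linear _ _ _ V (fun b => (eps alpha b.2)%:~R *:
       (basis_vector (b.1, alpha + b.2) : V))).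

Lemma shift_basis alpha b : shift eps alpha (basis_vector b) =
  (eps alpha b.2)%:~R *: basis_vector (b.1, alpha + b.2).
Proof. exact: linext_basis. Qed.

Lemma shift_heis alpha x n v :
  shift eps alpha (heis x (Negz n) v) = heis x (Negz n) (shift eps alpha v).
Proof.
have shift_u i : shift eps alpha (heis (ubasis R i) (Negz n) v) =
    heis (ubasis R i) (Negz n) (shift eps alpha v).
  move: v; pose f1 : V -> V := shift eps alpha \o heis (ubasis R i) (Negz n).
  pose f2 : V -> V := heis (ubasis R i) (Negz n) \o shift eps alpha.
  apply: (@VL_ext _ _ _ _ f1 f2) => b; rewrite /f1 /f2 /=.
  by rewrite shift_basis heis_ubasis linearZ /= heis_ubasis /= shift_basis.
apply: etrans (congr1 (shift eps alpha) (heisE x (Negz n) v)) _.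
apply: etrans _ (esym (heisE x (Negz n) (shift eps alpha v))).
pose f : {linear V -> V} := shift eps alpha.
apply: etrans (linear_sum f _ _ _) _; apply: eq_bigr => i _.
apply: etrans (linearZ_LR f _ _) _.
exact: (congr1 ( *:%R (x 0 i)) (shift_u i)).
Qed.

Definition raising alpha n v : V := n%:R^-1 *: heis (to_h alpha) (- n%:Z) v.
Definition lowering alpha n v : V := - (n%:R^-1 *: heis (to_h alpha) n%:Z v).

(** The coefficient of [z ^ (k - l + (alpha|beta))] contributed by the terms
    [z ^ k] and [z ^ (- l)] of the two exponentials in [Y(e^alpha, z)]. *)
Definition Y_exp_term alpha (p : nat * nat) v : V :=
  series_exp (raising alpha) p.1 (series_exp (lowering alpha) p.2 (shift eps alpha v)).

Lemma raising_linear alpha n : linear (raising alpha n).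
Proof.
move=> c u v; rewrite /raising linearP scalerDr !scalerA.
by rewrite [_ * c]mulrC.
Qed.

Lemma lowering_linear alpha n : linear (lowering alpha n).
Proof.
move=> c u v; rewrite /lowering linearP scalerDr !scalerA.
by rewrite [_ * c]mulrC opprD scalerN scalerA.
Qed.

Lemma Y_exp_term_linear alpha p : linear (Y_exp_term alpha p).
Proof.
move=> c u v; rewrite /Y_exp_term linearP.
rewrite (series_exp_linear _ (lowering_linear alpha)).
by rewrite (series_exp_linear _ (raising_linear alpha)).
Qed.

HB.instance Definition _ alpha p :=
  GRing.isLinear.Build C V V *:%R (Y_exp_term alpha p) (Y_exp_term_linear alpha p).

Lemma degree_lt_shift alpha d v : degree_lt d v -> degree_lt d (shift eps alpha v).
Proof.
apply: supported_linear => b bd; rewrite [X in supported _ X]shift_basis.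
by apply/supportedZ/supported_basis; case: b bd.
Qed.

Lemma Y_exp_term_eq0 alpha p d v : degree_lt d v -> (d <= p.2)%N ->
  Y_exp_term alpha p v = 0.
Proof.
move=> dv dp; rewrite /Y_exp_term [X in series_exp _ _ X]degree_lt0; last first.
  apply: (degree_lt_le _ (degree_lt_series_exp (N := p.2) _
    (degree_lt_shift alpha dv))); first by lia.
  move=> [//|n] e u _ eu; rewrite /lowering -scaleNr; apply/supportedZ.
  exact: degree_lt_heis.
have := series_exp_linear p.1 (raising_linear alpha) (-1) 0 0.
by rewrite scaler0 addr0 scaleN1r addNr.
Qed.

Definition Y_exp_indices (D : R) (N : int) : set (nat * nat) :=
  [set p | p.1%:R - p.2%:R + D = N%:~R].

Lemma Y_expE alpha N v : Y_exp eps alpha N v =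
  linext (fun b => \sum_(p \in Y_exp_indices (dot (\val alpha) (\val b.2)) N)
                     Y_exp_term alpha p (basis_vector b)) v.
Proof. by []. Qed.

Lemma Y_exp_indices_bound D : exists B : nat, forall N p,
  Y_exp_indices D N p -> p.1%:Z - p.2%:Z < N + B%:Z.
Proof.
have DB := archi_boundP (normr_ge0 D).
exists (Num.bound `|D|) => N [k l] /= kl.
have ND := ler_norm (- D); rewrite normrN in ND.
by rewrite -(ltr_int R) rmorphB rmorphD /= -kl /= -!pmulrn; lra.
Qed.

(** A vector is killed by the terms with large [p.2], so that only finitely
    many of the terms with a given power of [z] matter, and these can be taken
    from a set of indices that does not depend on the vector. *)
Lemma Y_exp_sum_finite D N d :
  exists s : seq (nat * nat), forall alpha v, degree_lt d v ->
    \sum_(p \in Y_exp_indices D N) Y_exp_term alpha p v =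
    \sum_(p <- s | `[< Y_exp_indices D N p >]) Y_exp_term alpha p v.
Proof.
have [B BP] := Y_exp_indices_bound D.
pose s := [fset p in allpairs pair (iota 0 (`|N| + B + d)) (iota 0 d)]%fset.
exists s => alpha v dv; rewrite fsbig_mkcond (fsbigTE s) => [|p ps]; last first.
  rewrite /patch; case: ifPn => // /set_mem pI; apply: Y_exp_term_eq0 dv _.
  rewrite leqNgt; apply: contra ps => pd; rewrite !inE /=.
  have := BP _ _ pI; case: p pd {pI} => k l /= ld kl.
  by apply/allpairsP; exists (k, l); split=> //=; rewrite mem_iota; lia.
rewrite [RHS]big_mkcond; apply: eq_bigr => p _; rewrite /patch.
by congr (if _ then _ else _); apply/idP/asboolP => [/set_mem|/mem_set].
Qed.

Lemma Y_exp_field alpha : is_field (Y_exp eps alpha : field V).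
Proof.
split=> [N|v]; first exact: linext_is_linear.
move: v (supportedT v); apply: supported_ind => [|c u v [k uk] [l vl]|b _].
- by exists 0%N => K _ N _; rewrite Y_expE linear0.
- exists (maxn k l) => K; rewrite geq_max => /andP[kK lK] N NK.
  have -> : Y_exp eps alpha N (c *: u + v) =
      c *: Y_exp eps alpha N u + Y_exp eps alpha N v by rewrite !Y_expE linearP.
  by rewrite (uk K) // (vl K) // scaler0 addr0.
have [B BP] := Y_exp_indices_bound (dot (\val alpha) (\val b.2)).
exists (B + degree b).+1 => K BK N NK; rewrite Y_expE linext_basis.
apply: fsbig1 => p /BP pN; apply: (@Y_exp_term_eq0 _ _ (degree b).+1).
  by apply: supported_basis => /=.
lia.
Qed.

(** [Y_exp] is defined on basis vectors, with a set of indices that depends on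
    the summand M(1,beta).  Within one summand the sums can be added up. *)
Lemma Y_exp_sector alpha beta N v : supported (fun b => b.2 = beta) v ->
  Y_exp eps alpha N v =
  \sum_(p \in Y_exp_indices (dot (\val alpha) (\val beta)) N) Y_exp_term alpha p v.
Proof.
move: v; apply: supported_ind => [|c u v IHu IHv|b <-].
- by rewrite Y_expE linear0 fsbig1 // => p _; rewrite linear0.
- have [du ulow] := degree_lt_exists u; have [dv vlow] := degree_lt_exists v.
  pose d := maxn du dv.
  have ud : degree_lt d u by apply: (degree_lt_le _ ulow); exact: leq_maxl.
  have vd : degree_lt d v by apply: (degree_lt_le _ vlow); exact: leq_maxr.
  have [s sP] := Y_exp_sum_finite (dot (\val alpha) (\val beta)) N d.
  have -> : Y_exp eps alpha N (c *: u + v) =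
      c *: Y_exp eps alpha N u + Y_exp eps alpha N v by rewrite !Y_expE linearP.
  have wd : degree_lt d (c *: u + v) by exact: supported_comb.
  rewrite (etrans IHu (sP alpha u ud)).
  rewrite (etrans IHv (sP alpha v vd)).
  apply/esym/(etrans (sP alpha (c *: u + v) wd)).
  by rewrite scaler_sumr -big_split; apply: eq_bigr => p _; rewrite linearP.
- by rewrite Y_expE linext_basis.
Qed.

End Vertex.

(** * Modes of the vertex operators *)

Section Modes.
Variables (R : realType) (r : nat) (L : zmodClosed 'rV[R]_r).
Local Notation C := R[i]%C.
Local Notation V := (VL L).
Local Notation h := 'rV[C]_r.
Variable eps : lattice L -> lattice L -> int.
Implicit Types (v : V) (x y : h) (b : basis_index L) (alpha beta : lattice L).

Opaque basis_vector linext.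

(** The field [Y(x(-n-1) 1, z)]. *)
Definition heis_field n x : field V := fderiv_div n (current x).

Lemma heis_field_field n x : is_field (heis_field n x).
Proof. exact/fderiv_div_field/current_field. Qed.

Lemma heis_field_creation n i : exists c : C, forall x v,
  heis_field n x (Posz i) v = c *: heis x (Negz (i + n)) v.
Proof.
eexists => x v; rewrite /heis_field fderiv_divE /current.
by have -> : - (Posz i + Posz n) - 1 = Negz (i + n) by lia.
Qed.

(** The [n]-th derivative kills [z ^ i] for [0 <= i < n], so that the negative
    powers of [z] in a derivative of [x(z)] come from negative powers in [x(z)]
    and have the [x(m)] with [m >= 0] as coefficients. *)
Lemma heis_field_annihilation n i : exists (c : C) (m : nat), forall x v,
  heis_field n x (Negz i) v = c *: heis x (Posz m) v.
Proof.
have [ni|i_n] := leqP n i.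
  eexists; exists (i - n)%N => x v; rewrite /heis_field fderiv_divE /current.
  by have -> : - (Negz i + Posz n) - 1 = Posz (i - n) by lia.
have prod0 : \prod_(k < n) (Negz i + Posz k + 1) = 0.
  by apply/eqP/prodf_eq0; exists (Ordinal i_n) => //=; lia.
exists 0, 0%N => x v.
rewrite /heis_field fderiv_divE prod0 mulr0z mulr0.
exact: etrans (scale0r _) (esym (scale0r _)).
Qed.

Lemma heis_field_comb n c x y :
  heis_field n (c *: x + y) =
  (fun N v => c *: heis_field n x N v + heis_field n y N v).
Proof.
apply/funext => N; apply/funext => v; rewrite -fderiv_div_comb.
congr (fderiv_div n _ N v); apply/funext => M; apply/funext => u.
exact: heis_linearl.
Qed.

Lemma heis_field0 n N v : heis_field n 0 N v = 0.
Proof.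
apply: etrans (fderiv_divE _ _ _ _) _.
by apply: etrans (congr1 _ (heis0l _ _)) _; exact: scaler0.
Qed.

Opaque heis_field heis.

Lemma heis_fieldCA n x m y B : is_field B ->
  normal_product (heis_field n x) (normal_product (heis_field m y) B) =
  normal_product (heis_field m y) (normal_product (heis_field n x) B).
Proof.
move=> Bf; apply/funext => N; apply/funext => v.
apply: (normal_productCA N v (heis_field_field n x) (heis_field_field m y) Bf).
  move=> i j w; have [c cE] := heis_field_creation n i.
  have [d dE] := heis_field_creation m j.
  have CC := heis_commute x y w (isT : (Negz (i + n) + Negz (j + m) == 0) ==> _).
  by rewrite 2!(cE x) 2!(dE y) 2!heisZ CC 2!scalerA mulrC.
move=> i j w; have [c [k cE]] := heis_field_annihilation n i.
have [d [l dE]] := heis_field_annihilation m j.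
have kl : (Posz k + Posz l == 0) ==> (Posz k == 0) by apply/implyP; lia.
by rewrite 2!(cE x) 2!(dE y) 2!heisZ (heis_commute x y w kl) 2!scalerA mulrC.
Qed.

(** The vertex operator of [u_i1(-n1-1) ... u_ik(-nk-1) e^alpha], computed with
    the factors in the given order. *)
Definition Y_seq alpha (s : seq ('I_r * nat)) : field V :=
  foldr (fun p => normal_product (heis_field p.2 (ubasis R p.1))) (Y_exp eps alpha) s.

Lemma Y_seq_field alpha s : is_field (Y_seq alpha s).
Proof.
elim: s => [|p s IH] /=; first exact: Y_exp_field.
exact: (normal_product_field (heis_field_field _ _) IH).
Qed.

Lemma Y_seq_swap alpha p q s : Y_seq alpha (p :: q :: s) = Y_seq alpha (q :: p :: s).
Proof. exact/heis_fieldCA/Y_seq_field. Qed.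

Lemma Y_seq_cons alpha p s t :
  Y_seq alpha s = Y_seq alpha t -> Y_seq alpha (p :: s) = Y_seq alpha (p :: t).
Proof. exact: congr1. Qed.

Lemma Y_seqE alpha p s : Y_seq alpha (p :: s) =
  normal_product (heis_field p.2 (ubasis R p.1)) (Y_seq alpha s).
Proof. by []. Qed.

Opaque Y_seq.

Lemma Y_seq_perm alpha s t : perm_eq s t -> Y_seq alpha s = Y_seq alpha t.
Proof.
apply: (catCA_perm_subst (F := Y_seq alpha)) => t1 t2 t3.
elim: t1 t2 => [|p t1 IH] t2; first exact: erefl.
rewrite cat_cons (Y_seq_cons p (IH t2)) cat_cons.
elim: t2 => [|q t2 IH2]; first exact: erefl.
by rewrite !cat_cons Y_seq_swap; exact: Y_seq_cons.
Qed.

Lemma Y_lattice_basis b : Y_lattice eps (basis_vector b) = Y_seq b.2 (enum_mset b.1).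
Proof.
by apply/funext => N; apply/funext => v; rewrite /Y_lattice linext_basis.
Qed.

Lemma Y_lattice_comb c (a a' : V) :
  Y_lattice eps (c *: a + a') =
  (fun N v => c *: Y_lattice eps a N v + Y_lattice eps a' N v).
Proof. by apply/funext => N; apply/funext => v; rewrite /Y_lattice linearP. Qed.

Lemma Y_lattice0 : Y_lattice eps 0 = (fun _ _ => 0).
Proof. by apply/funext => N; apply/funext => v; rewrite /Y_lattice linear0. Qed.

Lemma Y_lattice_field (a : V) : is_field (Y_lattice eps a).
Proof.
move: a (supportedT a); apply: supported_ind => [|c a a' af a'f|b _].
- by rewrite Y_lattice0; exact: is_field0.
- by rewrite Y_lattice_comb; exact: is_field_comb.
- by rewrite Y_lattice_basis; exact: Y_seq_field.
Qed.

Opaque Y_lattice.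

(** For a basis vector [x] of h and a basis vector [a] of V_L this is the
    definition of [Y], except that the new factor need not come first in the
    order chosen there.  Both sides are linear in [x] and in [a]. *)
Lemma Y_lattice_heis x n (a : V) :
  Y_lattice eps (heis x (Negz n) a) =
  normal_product (heis_field n x) (Y_lattice eps a).
Proof.
have Yu i : Y_lattice eps (heis (ubasis R i) (Negz n) a) =
    normal_product (heis_field n (ubasis R i)) (Y_lattice eps a).
  move: a (supportedT a); apply: supported_ind => [|c a a' IH IH'|b _].
  - rewrite linear0 Y_lattice0; apply/funext => N; apply/funext => v.
    by rewrite normal_product0r //; exact: heis_field_field.
  - have E := heis_is_linear (ubasis R i) (Negz n) c a a'.
    rewrite E (Y_lattice_comb c a a').
    apply: etrans (Y_lattice_comb _ _ _) _; apply/funext => N; apply/funext => v.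
    apply: etrans (congr2 (fun A B : field V => c *: A N v + B N v) IH IH') _.
    apply/esym/normal_product_linearr; first exact: heis_field_field.
      exact: Y_lattice_field.
    exact: Y_lattice_field.
  - apply: etrans (congr1 (Y_lattice eps) (heis_ubasis i (Negz n) b)) _.
    apply: etrans (Y_lattice_basis (((i, n) +` b.1)%mset, b.2)) _.
    apply: etrans (@Y_seq_perm b.2 _ ((i, n) :: enum_mset b.1) _) _.
      apply/allP => q _; apply/eqP.
      by rewrite /= !count_mem_mset msetE2 msetnE [_ == q]eq_sym; case: eqP.
    apply: etrans (Y_seqE _ _ _) _.
    exact: (congr1 (normal_product (heis_field n (ubasis R i))) (esym (Y_lattice_basis b))).
rewrite [x]row_sum_delta; elim/big_rec: _ => [|i y _ IH].
  rewrite heis0l Y_lattice0; apply/funext => N; apply/funext => v.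
  rewrite normal_product0l //; last exact: Y_lattice_field.
  exact: heis_field0.
apply: etrans (congr1 (Y_lattice eps) (heis_linearl (Negz n) a _ _ _)) _.
apply: etrans (Y_lattice_comb _ _ _) _.
rewrite heis_field_comb; apply/funext => N; apply/funext => v.
apply: etrans (congr2 (fun A B : field V => x 0 i *: A N v + B N v) (Yu i) IH) _.
apply/esym/normal_product_linearl.
- exact: heis_field_field.
- exact: heis_field_field.
- exact: Y_lattice_field.
Qed.

End Modes.

(** * Lifts are automorphisms *)

Lemma scaler_comb (K : comNzRingType) (W : lmodType K) (c d : K) (v v' : W) :
  d *: (c *: v + v') = c *: (d *: v) + d *: v'.
Proof. by rewrite scalerDr !scalerA mulrC. Qed.

Lemma sum_scale_delta (K : nzRingType) (W : lmodType K) (I : finType) (j : I)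
    (f : I -> W) : \sum_k (j == k)%:R *: f k = f j.
Proof.
rewrite (bigD1 j) //= eqxx scale1r big1 ?addr0 // => k kj.
by rewrite eq_sym (negPf kj) scale0r.
Qed.

Section Automorphism.
Variables (R : realType) (r : nat) (L : zmodClosed 'rV[R]_r).
Local Notation C := R[i]%C.
Local Notation V := (VL L).
Local Notation h := 'rV[C]_r.
Variable eps : lattice L -> lattice L -> int.
Implicit Types (v : V) (x y : h) (b : basis_index L) (alpha beta : lattice L).

Variables (M : 'M[R]_r) (w : lattice L -> lattice L) (u : lattice L -> C).
Hypothesis MM : M *m M^T = 1%:M.
Hypothesis wM : forall alpha, \val (w alpha) = \val alpha *m M.
Hypothesis u_eps : forall alpha beta,
  (eps alpha beta)%:~R * u (alpha + beta) =
  u alpha * u beta * (eps (w alpha) (w beta))%:~R.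
Local Notation Mc := (map_mx (real_complex R) M).

Variable g : {linear V -> V}.
Hypothesis gexp : forall beta, g (exp_vector beta) = u beta *: exp_vector (w beta).
Hypothesis gheis : forall x m v, g (heis x m v) = heis (x *m Mc) m (g v).

Transparent heis_field.

Lemma lift_heis_field n x N v :
  g (heis_field n x N v) = heis_field n (x *m Mc) N (g v).
Proof.
rewrite /heis_field.
apply: (@fderiv_div_intertwine _ _ _ g n (current x) (current (x *m Mc))) => N' v'.
exact: gheis.
Qed.

Opaque basis_vector linext heis heis_field Y_lattice Y_seq Y_exp.

Lemma isometryD alpha beta : w (alpha + beta) = w alpha + w beta.
Proof. by apply/val_inj; rewrite wM !raddfD /= mulmxDl -!wM. Qed.

(** The shifts commute with the creation operators, so that it is enough to
    compare both sides on [e^beta], where they agree by the equation for [u]. *)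
Lemma lift_shift alpha v :
  g (shift eps alpha v) = u alpha *: shift eps (w alpha) (g v).
Proof.
pose f1 : {linear V -> V} := g \o shift eps alpha.
pose f2 : {linear V -> V} := u alpha \*: (shift eps (w alpha) \o g).
move: v; apply: (@fock_ext _ _ _ _ f1 f2
    (fun i n v => heis (ubasis R i *m Mc) (Negz n) v)) => [beta|i n v|i n v].
- apply: etrans (congr1 g (shift_basis _ _ _)) _.
  apply: etrans (linearZ_LR g _ _) _.
  apply: etrans (congr1 ( *:%R _) (gexp _)) _.
  apply: etrans _ (esym (congr1 (fun v => u alpha *: shift eps (w alpha) v) (gexp beta))).
  apply: etrans _ (esym (congr1 ( *:%R _)
    (linearZ_LR (shift eps (w alpha) : {linear V -> V}) _ _))).
  apply: etrans _ (esym (congr1 (fun v => u alpha *: (u beta *: v))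
    (shift_basis _ _ _))).
  by rewrite !scalerA isometryD u_eps.
- apply: etrans (congr1 g (shift_heis _ _ _ _ _)) _; exact: gheis.
- apply: etrans (congr1 (fun v => u alpha *: shift eps (w alpha) v) (gheis _ _ _)) _.
  apply: etrans (congr1 ( *:%R _) (shift_heis _ _ _ _ _)) _.
  exact: esym (heisZ _ _ _ _).
Qed.

Lemma scaled_linear (f : V -> V) c v : linear f -> f (c *: v) = c *: f v.
Proof.
move=> flin; pose fl : {linear V -> V} := HB.pack_for {linear V -> V} f
    (GRing.isLinear.Build C V V *:%R f flin).
exact: (linearZ_LR fl).
Qed.

Lemma lift_raising alpha n v :
  g (raising alpha n v) = raising (w alpha) n (g v).
Proof.
apply: etrans (linearZ_LR g _ _) _; apply: (congr1 ( *:%R _)).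
apply: etrans (gheis _ _ _) _.
exact: (congr1 (fun x => heis x _ _) (esym (to_h_isometry wM alpha))).
Qed.

Lemma lift_lowering alpha n v :
  g (lowering alpha n v) = lowering (w alpha) n (g v).
Proof.
apply: etrans (raddfN g _) _; apply: (congr1 -%R).
apply: etrans (linearZ_LR g _ _) _; apply: (congr1 ( *:%R _)).
apply: etrans (gheis _ _ _) _.
exact: (congr1 (fun x => heis x _ _) (esym (to_h_isometry wM alpha))).
Qed.

Lemma lift_Y_exp_term alpha p v :
  g (Y_exp_term eps alpha p v) = u alpha *: Y_exp_term eps (w alpha) p (g v).
Proof.
apply: etrans (series_exp_intertwine
  (fun n v _ => lift_raising alpha n v) _ _) _.
apply: etrans (congr1 (series_exp (raising (w alpha)) p.1) (series_exp_intertwine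
  (fun n v _ => lift_lowering alpha n v) _ _)) _.
apply: etrans (congr1 (fun v => series_exp (raising (w alpha)) p.1
  (series_exp (lowering (w alpha)) p.2 v)) (lift_shift alpha v)) _.
apply: etrans (congr1 (series_exp (raising (w alpha)) p.1)
  (scaled_linear _ _ (series_exp_linear _ (lowering_linear (w alpha))))) _.
exact: (scaled_linear _ _ (series_exp_linear _ (raising_linear (w alpha)))).
Qed.

Lemma dot_isometry alpha beta :
  dot (\val (w alpha)) (\val (w beta)) = dot (\val alpha) (\val beta).
Proof. by rewrite !wM dot_orthogonal. Qed.

(** The sets of indices that occur on both sides are equal, because the isometry
    preserves [(alpha|beta)], and the sums are finite, so that [g] can be moved
    inside. *)
Lemma lift_Y_exp alpha N v :
  g (Y_exp eps alpha N v) = u alpha *: Y_exp eps (w alpha) N (g v).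
Proof.
have YL a : linear (Y_exp eps a N : V -> V) by have [] := Y_exp_field eps a.
have PI c a a' : g (Y_exp eps alpha N (c *: a + a')) =
    c *: g (Y_exp eps alpha N a) + g (Y_exp eps alpha N a').
  by rewrite YL linearP.
move: v (supportedT v); apply: supported_ind => [|c a a' IH IH'|b _].
- have Y0 a : Y_exp eps a N (0 : V) = 0 by exact/field0/Y_exp_field.
  apply: etrans (congr1 g (Y0 _)) _; apply: etrans (linear0 g) _; apply: esym.
  apply: etrans (congr1 (fun v => u alpha *: Y_exp eps (w alpha) N v) (linear0 g)) _.
  apply: etrans (congr1 ( *:%R _) (Y0 _)) _; exact: scaler0.
- apply: etrans (PI _ _ _) _.
  apply: etrans (congr2 (fun v v' : V => c *: v + v') IH IH') _; apply: esym.
  apply: etrans (congr1 (fun v => u alpha *: Y_exp eps (w alpha) N v) (linearP g _ _ _)) _.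
  apply: etrans (congr1 ( *:%R _) (YL _ _ _ _)) _.
  exact: scaler_comb.
(* One bound on the degrees of both vectors gives one finite set of indices. *)
have [d bd] := degree_lt_exists (basis_vector b : V).
have [d' bd'] := degree_lt_exists (g (basis_vector b) : V).
pose e := maxn d d'.
have be : degree_lt e (basis_vector b) by apply: (degree_lt_le _ bd); exact: leq_maxl.
have be' : degree_lt e (g (basis_vector b)) by apply: (degree_lt_le _ bd'); exact: leq_maxr.
have [s sP] := Y_exp_sum_finite eps (dot (\val alpha) (\val b.2)) N e.
have bS : supported (fun b' => b'.2 = b.2) (basis_vector b) by exact: supported_basis.
have E1 := etrans (Y_exp_sector eps alpha N bS) (sP alpha _ be).
have E2 := Y_exp_sector eps (w alpha) N (lift_supported gexp gheis (b := b)).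
rewrite dot_isometry in E2.
have {}E2 := etrans E2 (sP (w alpha) _ be').
apply: etrans (congr1 g E1) _; apply: etrans _ (esym (congr1 ( *:%R _) E2)).
apply: etrans (linear_sum g _ _ _) _; apply: etrans _ (esym (scaler_sumr _ _ _ _)).
by apply: eq_bigr => p _; exact: lift_Y_exp_term.
Qed.

(** By induction on the number of creation operators in [a]: they act on both
    sides by normally ordered products with fields that [g] intertwines. *)
Lemma lift_Y a N v : g (Y_lattice eps a N v) = Y_lattice eps (g a) N (g v).
Proof.
move: a N v; apply: fock_ind => [|c a a' IH IH'|beta|i n a IH] N v.
- apply: etrans (congr1 (fun A : field V => g (A N v)) (Y_lattice0 _)) _.
  apply: etrans (linear0 g) _; apply: esym.
  apply: etrans (congr1 (fun a => Y_lattice eps a N (g v)) (linear0 g)) _.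
  exact: (congr1 (fun A : field V => A N (g v)) (Y_lattice0 eps)).
- apply: etrans (congr1 (fun A : field V => g (A N v)) (Y_lattice_comb _ _ _ _)) _.
  apply: etrans (linearP g _ _ _) _.
  apply: etrans (congr2 (fun v v' : V => c *: v + v') (IH N v) (IH' N v)) _.
  apply: esym.
  apply: etrans (congr1 (fun a => Y_lattice eps a N (g v)) (linearP g _ _ _)) _.
  exact: (congr1 (fun A : field V => A N (g v)) (Y_lattice_comb _ _ _ _)).
- have Ye gamma : Y_lattice eps (exp_vector gamma) = Y_exp eps gamma.
    by apply: etrans (Y_lattice_basis _ _) _; rewrite /= enum_mset0.
  apply: etrans (congr1 (fun A : field V => g (A N v)) (Ye beta)) _.
  apply: etrans (lift_Y_exp _ _ _) _; apply: esym.
  apply: etrans (congr1 (fun a => Y_lattice eps a N (g v)) (gexp beta)) _.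
  rewrite -[u beta *: _]addr0.
  apply: etrans (congr1 (fun A : field V => A N (g v)) (Y_lattice_comb _ _ _ _)) _.
  apply: etrans (congr2 (fun A B : field V => u beta *: A N (g v) + B N (g v))
    (Ye (w beta)) (Y_lattice0 _)) _.
  exact: addr0.
apply: etrans (congr1 (fun A : field V => g (A N v)) (Y_lattice_heis _ _ _ _)) _.
apply: etrans _ (esym (congr1 (fun a => Y_lattice eps a N (g v)) (gheis _ _ _))).
apply: etrans _ (esym (congr1 (fun A : field V => A N (g v)) (Y_lattice_heis _ _ _ _))).
apply: (normal_product_intertwine _ _ _ _ _ IH).
- exact: heis_field_field.
- exact: Y_lattice_field.
- exact: heis_field_field.
- exact: Y_lattice_field.
- exact: lift_heis_field.
Qed.

Lemma isometry0 : w 0 = 0.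
Proof. by apply/val_inj; rewrite wM /= mul0mx. Qed.

(** The sum of the [u_i(-1)^2 1] does not depend on the orthonormal basis. *)
Lemma lift_conformal :
  u 0 = 1 -> g (conformal_vector (lattice_voa eps)) = conformal_vector (lattice_voa eps).
Proof.
move=> u0 /=.
have g0 : g (exp_vector 0) = exp_vector 0 by rewrite gexp isometry0 u0 scale1r.
apply: etrans (linearZ_LR g _ _) _; apply: (congr1 ( *:%R _)).
apply: etrans (linear_sum g _ _ _) _.
have E1 i : g (heis (ubasis R i) (-1) (heis (ubasis R i) (-1) (exp_vector 0))) =
    \sum_j \sum_k (Mc i j * Mc i k) *:
      heis (ubasis R j) (-1) (heis (ubasis R k) (-1) (exp_vector 0)).
  apply: etrans (gheis _ _ _) _.
  apply: etrans (congr1 _ (gheis _ _ _)) _.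
  apply: etrans (congr1 (fun v => heis _ _ (heis _ _ v)) g0) _.
  apply: etrans (heisE _ _ _) _; apply: eq_bigr => j _.
  apply: etrans (congr1 (fun v => _ *: heis _ _ v) (heisE _ _ _)) _.
  pose f : {linear V -> V} := heis (ubasis R j) (-1).
  apply: etrans (congr1 ( *:%R _) (linear_sum f _ _ _)) _.
  apply: etrans (scaler_sumr _ _ _ _) _; apply: eq_bigr => k _.
  apply: etrans (congr1 ( *:%R _) (linearZ_LR f _ _)) _.
  by rewrite scalerA /ubasis -!rowE !mxE.
apply: etrans (eq_bigr _ (fun i _ => E1 i)) _.
apply: etrans (exchange_big _ _ _ _ _ _) _; apply: eq_bigr => j _.
apply: etrans (exchange_big _ _ _ _ _ _) _.
have E2 k : \sum_i (Mc i j * Mc i k) *: heis (ubasis R j) (-1)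
    (heis (ubasis R k) (-1) (exp_vector 0)) = (j == k)%:R *: heis (ubasis R j) (-1)
    (heis (ubasis R k) (-1) (exp_vector 0 : V)).
  apply: etrans (esym (scaler_suml _ _ _ _)) _; apply: (congr1 (fun c => c *: _)).
  have := congr1 (fun A : 'M_r => A j k) (mulmx1C (Mc_orthogonal MM)).
  rewrite !mxE => <-; apply: eq_bigr => i _.
  by rewrite !mxE.
apply: etrans (eq_bigr _ (fun k _ => E2 k)) _.
exact: sum_scale_delta.
Qed.

Lemma lift_automorphism :
  u 0 = 1 -> bijective g -> is_voa_automorphism (V := lattice_voa eps) g.
Proof.
move=> u0 gbij; split; first exact: gbij.
- by apply: etrans (gexp 0) _; rewrite isometry0 u0 scale1r.
- exact: lift_conformal.
- by move=> a b N; exact: lift_Y.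
Qed.

End Automorphism.

(** * Inverse lifts and conjugacy *)

Section Inverse.
Variables (R : realType) (r : nat) (L : zmodClosed 'rV[R]_r).
Local Notation C := R[i]%C.
Local Notation V := (VL L).
Local Notation cplx M := (map_mx (real_complex R) M).

Opaque basis_vector linext heis.

(** The composite fixes every [e^beta] and commutes with the creation
    operators. *)
Lemma lift_cancel (M M' : 'M[R]_r) (w w' : lattice L -> lattice L)
    (u u' : lattice L -> C) (g g' : {linear V -> V}) :
  M *m M' = 1%:M -> cancel w w' -> (forall beta, u beta * u' (w beta) = 1) ->
  (forall beta, g (exp_vector beta) = u beta *: exp_vector (w beta)) ->
  (forall x m v, g (heis x m v) = heis (x *m cplx M) m (g v)) ->
  (forall beta, g' (exp_vector beta) = u' beta *: exp_vector (w' beta)) ->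
  (forall x m v, g' (heis x m v) = heis (x *m cplx M') m (g' v)) ->
  cancel g g'.
Proof.
move=> MM' ww' uu' gexp gheis g'exp g'heis.
have MMC : cplx M *m cplx M' = 1%:M by rewrite -map_mxM MM' map_mx1.
pose f1 : {linear V -> V} := g' \o g.
apply: (@fock_ext _ _ _ _ f1 idfun (fun i n v => heis (ubasis R i) (Negz n) v)).
- move=> beta; apply: etrans (congr1 g' (gexp beta)) _.
  apply: etrans (linearZ_LR g' _ _) _.
  apply: etrans (congr1 ( *:%R _) (g'exp _)) _.
  by rewrite scalerA uu' scale1r ww'.
- move=> i n v; apply: etrans (congr1 g' (gheis _ _ _)) _.
  apply: etrans (g'heis _ _ _) _.
  by rewrite -mulmxA MMC mulmx1.
- by [].
Qed.

Lemma sub_lattice_voaP (eps : lattice L -> lattice L -> int)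
    (A : set (lattice L)) (v : V) :
  sub_lattice_voa eps A v <-> supported (fun b => A b.2) v.
Proof.
split=> [vA b nAb|vA b bv].
  by apply/eqP; apply/negPn/negP; rewrite mcoeff_neq0 => /vA.
apply: contrapT => /vA v0; move: bv.
by rewrite -mcoeff_neq0 v0 eqxx.
Qed.

Lemma image_sub_lattice_voa (eps : lattice L -> lattice L -> int)
    (g g' : {linear V -> V}) (A B : set (lattice L)) :
  cancel g' g ->
  (forall v, supported (fun b => A b.2) v -> supported (fun b => B b.2) (g v)) ->
  (forall v, supported (fun b => B b.2) v -> supported (fun b => A b.2) (g' v)) ->
  g @` sub_lattice_voa eps A = sub_lattice_voa eps B.
Proof.
move=> g'K gAB gBA; apply/seteqP; split=> v.
  by move=> [v' /sub_lattice_voaP v'A <-]; exact/sub_lattice_voaP/gAB.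
move=> /sub_lattice_voaP vB; exists (g' v); last exact: g'K.
exact/sub_lattice_voaP/gBA.
Qed.

End Inverse.

Theorem proposition4p3 (R : realType) (r : nat) (Phi : {fset 'rV[R]_r})
  (hPhi : is_root_system Phi)
  (hnorm : forall a : 'rV[R]_r, a \in Phi -> dot a a = 2)
  (hADE : of_type_ADE Phi)
  (eps : lattice (root_lattice Phi) -> lattice (root_lattice Phi) -> int)
  (heps : is_cocycle eps)
  (D D' : r.-tuple 'rV[R]_r)
  (hD : is_basis Phi D) (hD' : is_basis Phi D') :
  exists g : {linear lattice_voa eps -> lattice_voa eps},
    is_voa_automorphism g /\ g @` conic_voa eps D = conic_voa eps D'.
Proof.
have [M [MM MP MTP] coneM] := bases_conjugate hPhi hD hD'.
have MTM : M^T *m M^T^T = 1%:M by rewrite trmxK; exact: mulmx1C.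
pose w := lattice_mx MP; pose w' := lattice_mx MTP.
have wM alpha : \val (w alpha) = \val alpha *m M by [].
have w'M alpha : \val (w' alpha) = \val alpha *m M^T by [].
have wK : cancel w w'.
  by move=> alpha; apply/val_inj; rewrite w'M wM -mulmxA MM mulmx1.
have w'K : cancel w' w.
  by move=> alpha; apply/val_inj; rewrite wM w'M -mulmxA (mulmx1C MM) mulmx1.
have [s sP] := cocycle_lift hPhi hnorm hD heps (isometryD wM) (dot_isometry MM wM).
pose u alpha : R[i]%C := (-1) ^+ s alpha.
(* The inverse lift has the inverse signs, carried over by [w']. *)
pose u' alpha := u (w' alpha).
have u_eps alpha beta : (eps alpha beta)%:~R * u (alpha + beta) =
    u alpha * u beta * (eps (w alpha) (w beta))%:~R.
  have := congr1 (fun k : int => k%:~R : R[i]%C) (sP alpha beta).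
  by rewrite !rmorphM !rmorph_sign.
have uu : forall alpha, u alpha * u alpha = 1 by move=> alpha; rewrite -expr2 sqrr_sign.
have [_ _ _ eps0] := heps.
(* The equation for [u] at [(0, 0)] reads [u 0 = u 0 * u 0 = 1]. *)
have u0 : u 0 = 1.
  have w0 : w 0 = 0 by exact: isometry0 wM.
  by have := u_eps 0 0; rewrite w0 addr0 (eps0 0).1 uu rmorph1 !mul1r.
have [g [gexp gheis]] := lift_exists u MM wM.
have [g' [g'exp g'heis]] := lift_exists u' MTM w'M.
have gK : cancel g g'.
  by apply: lift_cancel gexp gheis g'exp g'heis => // beta; rewrite /u' wK.
have g'K : cancel g' g.
  apply: lift_cancel g'exp g'heis gexp gheis => [||beta].
  - exact: mulmx1C.
  - exact: w'K.
  - exact: uu.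
exists g; split; first exact: (lift_automorphism MM wM u_eps gexp gheis u0 (Bijective gK g'K)).
pose Q := lattice (root_lattice Phi).
pose A : set Q := [set gamma : Q | cone D (\val gamma)].
pose A' : set Q := [set gamma : Q | cone D' (\val gamma)].
have coneE E : conic_voa eps E = sub_lattice_voa eps [set gamma : Q | cone E (\val gamma)].
  by [].
rewrite (coneE D) (coneE D').
apply: (@image_sub_lattice_voa _ _ _ eps g g' A A' g'K) => v.
  by apply: (lift_sub_lattice gexp gheis (A := A) (B := A')) => beta /coneM.
apply: (lift_sub_lattice g'exp g'heis (A := A') (B := A)) => beta betaD'.
by apply/coneM; rewrite -mulmxA (mulmx1C MM) mulmx1.
Qed.
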